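(* Let $D$ be a nonempty finite set with $|D|\le 4$, and let $\mathcal O$ be a clone over $D$ which contains symmetric operations of each of the arities $1,2,\ldots,|D|$. Then $\mathcal O$ contains a symmetric operation of arity $k$ for every positive integer $k$.
   Context: An operation over $D$ of arity $k\ge 1$ is a function $f:D^k\to D$. The projections are $\pi_i^k(d_1,\ldots,d_k)=d_i$ for $k\ge 1$, $1\le i\le k$. A clone over $D$ is a set of finite-arity operations over $D$ that contains all projections and is closed under composition: if $f\in\mathcal O$ is $m$-ary and $g_1,\ldots,g_m\in\mathcal O$ are $n$-ary, then $f(g_1(x_1,\ldots,x_n),\ldots,g_m(x_1,\ldots,x_n))$ is in $\mathcal O$. A $k$-ary operation $f$ is symmetric if $f(x_1,\ldots,x_k)=f(x_{\sigma(1)},\ldots,x_{\sigma(k)})$ for all $x_1,\ldots,x_k\in D$ and all permutations $\sigma$ of $\{1,\ldots,k\}$. A clone is not assumed to be idempotent. *)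

(* Defs.v *)
From mathcomp Require Import all_boot all_fingroup.

Set Implicit Arguments.
Unset Strict Implicit.
Unset Printing Implicit Defensive.

(* Finite functions make extensionally equal operations Leibniz-equal, so a
   set of operations is just a predicate. *)
Definition operation (D : finType) (k : nat) := {ffun {ffun 'I_k -> D} -> D}.

Definition projection (D : finType) (k : nat) (i : 'I_k) : operation D k :=
  [ffun x : {ffun 'I_k -> D} => x i].

Definition composition (D : finType) (m n : nat)
    (f : operation D m) (g : 'I_m -> operation D n) : operation D n :=
  [ffun x : {ffun 'I_n -> D} => f [ffun i => g i x]].

Definition symmetric_op (D : finType) (k : nat) (f : operation D k) : Prop :=
  forall (x : {ffun 'I_k -> D}) (s : 'S_k), f x = f [ffun i => x (s i)].

(* [clone_arity] excludes nullary operations, so in [clone_composition] both m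
   and n are positive. *)
Record clone (D : finType) (O : forall k, operation D k -> Prop) : Prop := {
  clone_arity : forall k (f : operation D k), O k f -> 0 < k;
  clone_projection : forall k (i : 'I_k), O k (projection D i);
  clone_composition :
    forall m n (f : operation D m) (g : 'I_m -> operation D n),
      O m f -> (forall i, O n (g i)) -> O n (composition f g)
}.

(* Main.v *)
Require Import Defs.
From Stdlib Require Import ClassicalEpsilon.
From mathcomp Require Import all_boot all_fingroup.

(* Restricting to the image of a unary operation of least rank makes the
   symmetric operations idempotent.  Fix a k-tuple [x].  The functions
   [s |-> f (x o s)] on [S_k], for [f] in the clone, form a set [R] that is closed
   under the clone and under translation, and [f] is symmetric at [x] when its
   function is constant; the idempotent operations preserve what was already
   achieved at other tuples, so it is enough to find a constant in each such [R].

   Let [s] be the symmetric binary operation.  By induction on the size of the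
   algebra [A], [R] takes all values of [A] at each place and [A] has no proper
   congruence.  An enumeration of all commutative idempotent tables on at most
   four elements shows that one of the following holds.
   - Repeated replacement of [u] by [(v u) u] or [((v u) u) u] pushes all entries
     of a suitable [u] in [R] to a single element.
   - The same process leads to a set [C] on which some term in [s] is the dual
     discriminator.  By Baker-Pixley, [R] restricted to [C] is determined by its
     projections to two coordinates; counting over the group shows that these are
     bijections or full, unless there is a constant.
   - The invariant binary relations on [A], or on a three-element ideal [C] to
     which the process leads, are bijections or full.  No invariant ternary
     relation is the graph of a Latin square, whence any pairwise unlinked
     coordinates of [R] are independent.
   In the last two cases there are [|C|] members of [R], pairwise nowhere equal,
   and the symmetric operation of arity [|C|] sends them to a constant. *)

Set Implicit Arguments.
Unset Strict Implicit.
Unset Printing Implicit Defensive.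

(** * Translation-invariant sets of functions on a group *)

Section Terms.
Variables (T : Type) (s : T -> T -> T).

Definition rmul2 x y := s (s x y) y.
Definition rmul3 x y := s (rmul2 x y) y.

(** Candidates for the dual discriminator, in the argument order where the value is [b] if [b = c]
    and [a] otherwise. *)
Definition maj1 x y z :=
  rmul3 x (rmul3 y (s (s (rmul2 (s y z) x) (rmul2 (s x z) y)) (rmul2 (s x y) z))).
Definition maj2 x y z := rmul3 x (s (s (s x y) z) (s (s y z) x)).

End Terms.

Section Relations.

Variables (gT : finGroupType) (A : finType).
Notation vec := {ffun gT -> A}.
Implicit Types (R : {set vec}) (u v w : vec) (C D : {set A}).

Definition shift u (g : gT) : vec := [ffun x => u (g * x)%g].
Definition shift_closed R := forall u g, u \in R -> shift u g \in R.
Definition values R := [set u 1%g | u : vec in R].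
Definition pairs R x y : rel A :=
  fun a b => [exists u in R, (u x == a) && (u y == b)].
Definition restrict R C := [set u in R | [forall x, u x \in C]].
Definition lift2 (s : A -> A -> A) u v : vec := [ffun x => s (u x) (v x)].
Definition closed2 (s : A -> A -> A) R :=
  forall u v, u \in R -> v \in R -> lift2 s u v \in R.
Definition lift (p : seq A -> A) (us : seq vec) : vec :=
  [ffun x => p [seq u x | u : vec <- us]].
Definition closed_op k p R :=
  forall us : seq vec, size us = k -> {subset us <= R} -> lift p us \in R.
Definition closed_rel k (p : seq A -> A) (P : rel A) :=
  forall l : seq (A * A), size l = k -> all (fun q => P q.1 q.2) l ->
  P (p (unzip1 l)) (p (unzip2 l)).

Lemma valuesP R x a : shift_closed R ->
  reflect (exists2 u, u \in R & u x = a) (a \in values R).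
Proof.
move=> shR; apply: (iffP imsetP) => [[u uR ->]|[u uR <-]].
  by exists (shift u x^-1%g); [exact: shR | rewrite ffunE mulVg].
by exists (shift u x); [exact: shR | rewrite ffunE mulg1].
Qed.

Lemma pairsP R x y a b :
  reflect (exists2 u, u \in R & u x = a /\ u y = b) (pairs R x y a b).
Proof.
apply: (iffP existsP) => [[u /and3P[uR /eqP xa /eqP yb]]|[u uR [xa yb]]].
  by exists u.
by exists u; rewrite uR xa yb !eqxx.
Qed.

Lemma restrictP R C u :
  reflect (u \in R /\ forall x, u x \in C) (u \in restrict R C).
Proof. by rewrite inE; apply: (iffP andP) => -[? /forallP]. Qed.

Arguments pairsP {R x y a b}.
Arguments restrictP {R C u}.

Lemma restrict_shift R C : shift_closed R -> shift_closed (restrict R C).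
Proof.
move=> shR u g /restrictP[uR uC]; apply/restrictP; split; first exact: shR.
by move=> x; rewrite ffunE.
Qed.

Lemma values_restrict R C : values (restrict R C) \subset C.
Proof. by apply/subsetP => _ /imsetP[u /restrictP[_ uC] ->]. Qed.

(** * Pushing entries into a prescribed set *)

Section Step.

Variables (s : A -> A -> A) (R : {set vec}).

Definition keeps (t : A -> A -> A) C := forall x y, y \in C -> t x y \in C.

(** Backward closure of [C] under moves [a |-> t x a]. [keeps] quantifies over every left argument
    because, when [t v u] is formed in [R], only one entry of [v] can be prescribed. *)
Inductive reach D C : A -> Prop :=
  | Reach0 a of a \in C : reach D C a
  | ReachS t x a of t = rmul2 s \/ t = rmul3 s & keeps t C & keeps t D
      & reach D C (t x a) : reach D C a.

Definition step D C := forall a, a \in D -> reach D C a.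

Hypothesis clR : closed2 s R.

Lemma closed_rmul2 : closed2 (rmul2 s) R.
Proof.
move=> u v uR vR; suff -> : lift2 (rmul2 s) u v = lift2 s (lift2 s u v) v.
  by apply: (clR (clR uR vR)).
by apply/ffunP=> x; rewrite !ffunE.
Qed.

Lemma closed_rmul3 : closed2 (rmul3 s) R.
Proof.
move=> u v uR vR; suff -> : lift2 (rmul3 s) u v = lift2 s (lift2 (rmul2 s) u v) v.
  by apply: (clR (closed_rmul2 uR vR)).
by apply/ffunP=> x; rewrite !ffunE.
Qed.

Hypotheses (shR : shift_closed R) (valR : values R = setT).

(* A member of [R] valued in [D] with as many entries in [C] as possible has
   all of them in [C]: replacing [u] by [t v u] keeps the entries lying in [C],
   and the entry of [v] at one chosen place is arbitrary. *)
Lemma step_restrict D C :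
  step D C -> restrict R D != set0 -> restrict R C != set0.
Proof.
move=> stDC /set0Pn[u0 u0R].
pose N u := [set x | u x \in C].
case: (@arg_maxnP _ u0 [pred u | u \in restrict R D] (fun u => #|N u|) u0R).
move=> u /= uD maxu; apply/set0Pn; exists u; apply/restrictP.
have [uR uDv] := restrictP uD; split=> // x; apply: contraT => uxC.
suff [w [wD Nw wx]] :
    exists w, [/\ w \in restrict R D, N u \subset N w & w x \in C].
  suff: #|N u| < #|N w| by rewrite ltnNge maxu.
  apply: proper_card; apply/properP; split=> //; exists x; rewrite inE //.
suff gen b : reach D C b -> forall w, w x = b -> w \in restrict R D ->
    N u \subset N w -> exists w', [/\ w' \in restrict R D, N u \subset N w' & w' x \in C].
  by apply: (gen _ (stDC _ (uDv x)) u).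
elim=> {b}; first by move=> b bC w eqb wD Nw; exists w; rewrite eqb.
move=> t c b t23 kC kD _ IH w eqb wD Nw.
have [wR wDv] := restrictP wD.
have [v vR vx] : exists2 v, v \in R & v x = c.
  by apply/(valuesP x c shR); rewrite valR inE.
apply: (IH (lift2 t v w)); first by rewrite ffunE vx eqb.
  apply/restrictP; split; last by move=> y; rewrite ffunE; apply: kD.
  by case: t23 => ->; [apply: closed_rmul2 | apply: closed_rmul3].
by apply: (subset_trans Nw); apply/subsetP=> y; rewrite !inE ffunE; exact: kC.
Qed.

End Step.

(** Induction on cardinality in the form suited to merging three members: sets of at least three
    elements lose one of three chosen points, and [x = y] in the base case covers singletons. *)
Lemma set_three_ind (T : finType) (P : {set T} -> Prop) :
    P set0 -> (forall x y, P [set x; y]) ->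
    (forall (Y : {set T}) x y z, x \in Y -> y \in Y -> z \in Y -> x != y -> y != z -> z != x ->
       P (Y :\ x) -> P (Y :\ y) -> P (Y :\ z) -> P Y) ->
  forall Y, P Y.
Proof.
move=> P0 P2 P3 Y; elim: {Y}#|Y| {-2}Y (leqnn #|Y|) => [|k IH] Y.
  by rewrite leqn0 cards_eq0 => /eqP ->.
move=> leY; have [/card_gt2P[x [y [z [[xY yY zY] [xy yz zx]]]]]|] := boolP (2 < #|Y|).
  have del a : a \in Y -> P (Y :\ a).
    by move=> aY; apply: IH; move: leY; rewrite (cardsD1 a Y) aY.
  by apply: (P3 Y x y z) => //; apply: del.
rewrite -leqNgt => leY2; have [->//|/set0Pn[x xY]] := eqVneq Y set0.
suff [y ->] : exists y, Y = [set x; y] by [].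
have [Y1|/set0Pn[y /setD1P[yx yY]]] := eqVneq (Y :\ x) set0.
  by exists x; rewrite setUid; apply/eqP; rewrite eqEsubset sub1set xY andbT -setD_eq0 Y1.
exists y; apply/esym/eqP; rewrite eqEcard subUset !sub1set xY yY cards2 eq_sym yx.
exact: leq_trans leY2 _.
Qed.

(** * Baker-Pixley interpolation *)

Section BakerPixley.

Variables (R : {set vec}) (C : {set A}) (m : A -> A -> A -> A).
Hypothesis valC : forall u x, u \in R -> u x \in C.
Hypothesis clm : forall u v w, u \in R -> v \in R -> w \in R ->
  [ffun x => m (u x) (v x) (w x)] \in R.
Hypothesis mE : forall a b c, a \in C -> b \in C -> c \in C ->
  m a b c = if b == c then b else a.

(** Take members that agree with [t] on [Y] except perhaps at [x], at [y] and at [z]. At each place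
    at most one of the three is wrong, and [m] acts as a majority operation. *)
Lemma baker_pixley (t : gT -> A) (Y : {set gT}) :
  (forall x y, x \in Y -> y \in Y -> exists2 u, u \in R & u x = t x /\ u y = t y) ->
  R != set0 -> exists2 u, u \in R & forall y, y \in Y -> u y = t y.
Proof.
move=> tR /set0Pn[u0 u0R]; elim/set_three_ind: Y tR =>
  [_|x y tR|Y x y z xY yY zY xy yz zx IHx IHy IHz tR].
- by exists u0 => // y; rewrite inE.
- have [u uR [ux uy]] := tR x y (set21 _ _) (set22 _ _).
  by exists u => // z /set2P[] ->.
have del a : (forall b c, b \in Y :\ a -> c \in Y :\ a ->
    exists2 u, u \in R & u b = t b /\ u c = t c).
  by move=> b c /setD1P[_ bY] /setD1P[_ cY]; apply: tR.
have [[u uR ut] [v vR vt] [w wR wt]] := And3 (IHx (del x)) (IHy (del y)) (IHz (del z)).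
exists [ffun a => m (u a) (v a) (w a)]; first exact: clm.
move=> a aY; rewrite ffunE mE ?valC //.
have off b : a != b -> a \in Y :\ b by rewrite !inE aY andbT.
have [eqax|/off/ut ua] := eqVneq a x.
  by rewrite vt ?wt ?eqxx // off // eqax // eq_sym.
have [eqay|/off/vt va] := eqVneq a y; last by case: eqP.
by case: eqP => // ->; rewrite wt // off // eqay.
Qed.

End BakerPixley.

(** * Linked and independent coordinates *)

Section Sections.

Variables (R : {set vec}) (C : {set A}).

Definition full x y := forall a b, a \in C -> b \in C -> pairs R x y a b.
(** The entries at [x] and [y] form the graph of a bijection. *)
Definition linked x y :=
  [forall u in R, forall v in R, (u x == v x) == (u y == v y)].

Lemma linkedP {x y} :
  reflect {in R &, forall u v, (u x == v x) = (u y == v y)} (linked x y).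
Proof.
apply: (iffP forall_inP) => H; first by move=> u v uR vR; move/forall_inP: (H u uR) => /(_ v vR)/eqP.
by move=> u uR; apply/forall_inP => v vR; rewrite H.
Qed.

Hypothesis dich : forall x y, linked x y \/ full x y.
Hypothesis free : forall (Y : {set gT}) (t : gT -> A),
  {in Y &, forall x y, x != y -> full x y} -> (forall y, y \in Y -> t y \in C) ->
  exists2 u, u \in R & forall y, y \in Y -> u y = t y.

(* The members of [R] that are constant on a transversal of the linkage classes
   of coordinates are, pairwise, nowhere equal. *)
Lemma disjoint_sections : exists sg : A -> vec,
  (forall a, a \in C -> sg a \in R) /\ (forall x, {in C &, injective (fun a => sg a x)}).
Proof.
have lrefl x : linked x x by apply/linkedP.
have leq x y : linked x y -> linked x =1 linked y.
  move=> /linkedP lxy z; apply/linkedP/linkedP => H u v uR vR.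
    by rewrite -lxy ?H.
  by rewrite lxy ?H.
(* Linkage is an equivalence, so the picked coordinate depends only on the class of [x]. *)
pose rep x := odflt x [pick y | linked x y].
have lrep x : linked x (rep x).
  by rewrite /rep; case: pickP => [y //|/(_ x)]; rewrite lrefl.
have rep_eq x y : linked x y -> rep x = rep y.
  move=> lxy; rewrite /rep (eq_pick (leq _ _ lxy)).
  by case: pickP => // /(_ y); rewrite lrefl.
pose Y := [set rep x | x : gT].
have indep : {in Y &, forall x y, x != y -> full x y}.
  move=> _ _ /imsetP[x _ ->] /imsetP[y _ ->] neq.
  have [lxy|//] := dich (rep x) (rep y); case/eqP: neq.
  rewrite (rep_eq _ _ (lrep x)) (rep_eq _ _ (lrep y)); exact: rep_eq.
have secP a : a \in C -> exists u, (u \in R) && [forall y in Y, u y == a].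
  move=> aC; have [u uR ua] := free indep (fun _ => fun _ => aC).
  by exists u; rewrite uR; apply/forall_inP => y /ua ->.
pose sg a : vec := odflt [ffun=> a] [pick u in R | [forall y in Y, u y == a]].
have sgP a : a \in C -> sg a \in R /\ forall x, sg a (rep x) = a.
  move=> /secP[u uP]; rewrite /sg; case: pickP => [v /andP[vR /forall_inP va]|/(_ u)].
    by split=> // x; apply/eqP/va/imset_f.
  by rewrite uP.
exists sg; split=> [a /sgP[]//|x a b /sgP[aR sga] /sgP[bR sgb] /eqP].
by rewrite (linkedP (lrep x)) // sga sgb => /eqP.
Qed.

End Sections.

Arguments linkedP {R x y}.

Definition has_constant R := exists2 u, u \in R & forall x y, u x = u y.

Lemma perm_enum_image (C : {set A}) (f : A -> A) :
  {in C &, injective f} -> (forall a, a \in C -> f a \in C) ->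
  perm_eq [seq f a | a in C] (enum C).
Proof.
move=> injf fC; apply: uniq_perm; [|exact: enum_uniq|].
  by rewrite map_inj_in_uniq ?enum_uniq // => a b; rewrite !mem_enum; apply: injf.
have imC : [set f a | a in C] = C.
  apply/eqP; rewrite eqEcard card_in_imset // leqnn andbT.
  by apply/subsetP=> _ /imsetP[a aC ->]; apply: fC.
move=> b; rewrite mem_enum -[in RHS]imC; apply/mapP/imsetP => -[a aC ->]; exists a => //.
  by rewrite -mem_enum.
by rewrite mem_enum.
Qed.

(** At every place the values [sg a x], for [a] in [C], rearrange [enum C], so [p] returns
    [p (enum C)] everywhere. *)
Lemma sections_constant R (C : {set A}) (p : seq A -> A) (sg : A -> vec) :
    closed_op #|C| p R ->
    (forall l l', size l = #|C| -> perm_eq l l' -> p l = p l') ->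
    (forall a, a \in C -> sg a \in R) -> (forall a x, a \in C -> sg a x \in C) ->
    (forall x, {in C &, injective (fun a => sg a x)}) ->
  has_constant R.
Proof.
move=> clR symp sgR sgC sgI; exists (lift p [seq sg a | a in C]).
  by apply: clR; [rewrite size_map -cardE | move=> _ /mapP[a aC ->]; apply: sgR; rewrite -mem_enum].
have perm x : perm_eq [seq sg a x | a in C] (enum C).
  by apply: perm_enum_image => // a aC; apply: sgC.
move=> x y; rewrite !ffunE -!map_comp.
by rewrite (symp _ (enum C)) ?[RHS](symp _ (enum C)) ?size_map -?cardE //; apply: perm.
Qed.

(** * Binary projections under the dual discriminator *)

Section DualDiscriminator.

Variables (R : {set vec}) (C : {set A}) (m : A -> A -> A -> A).
Hypotheses (shR : shift_closed R) (valR : values R = C) (C_gt1 : 1 < #|C|).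
Hypothesis clm : forall u v w, u \in R -> v \in R -> w \in R ->
  [ffun x => m (u x) (v x) (w x)] \in R.
Hypothesis mE : forall a b c, a \in C -> b \in C -> c \in C ->
  m a b c = if b == c then b else a.

Let valC u x : u \in R -> u x \in C.
Proof. by move=> uR; rewrite -valR; apply/valuesP => //; exists u. Qed.

Let onto x a : a \in C -> exists2 u, u \in R & u x = a.
Proof. by rewrite -valR => /valuesP; apply. Qed.

(** [m w u v] keeps the common entry of [u] and [v] at [x], and takes the free entry of [w] at [y],
    where [u] and [v] differ. *)
Lemma full_row x y u v b : u \in R -> v \in R -> u x = v x -> u y != v y ->
  b \in C -> pairs R x y (u x) b.
Proof.
move=> uR vR ux uy bC; have [w wR <-] := onto y bC; apply/pairsP.
exists [ffun z => m (w z) (u z) (v z)]; first exact: clm.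
by rewrite !ffunE !mE ?valC // ux eqxx (negPf uy).
Qed.

Lemma pairs_sym x y a b : pairs R x y a b = pairs R y x b a.
Proof. by apply/pairsP/pairsP => -[u uR [ua ub]]; exists u. Qed.

Lemma full_sym x y : full R C x y -> full R C y x.
Proof. by move=> H a b aC bC; rewrite pairs_sym; apply: H. Qed.

(** The third kind of binary projection, beside bijections and the full one: the union of a row and
    a column (a two-fan). *)
Definition cross x y a b :=
  pairs R x y a b /\ forall w, w \in R -> w x = a \/ w y = b.

(** The row of [a] is full by [full_row]. If a second row has two entries it is full as well, and
    then so is every column. Otherwise each other row has a single entry; the column of one such
    entry also meets row [a], so it is full and contains the single entry of every other row. *)
Lemma unlinked_cross x y u v : u \in R -> v \in R -> u x = v x -> u y != v y ->
  full R C x y \/ exists a b, [/\ a \in C, b \in C & cross x y a b].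
Proof.
move=> uR vR ux uy; set a := u x; have row := full_row uR vR ux uy.
have aC : a \in C by exact: valC.
have [/existsP[w /andP[wR /existsP[w' /and4P[w'R wa /eqP ww' wy]]]]|] :=
    boolP [exists w, (w \in R) && [exists w', [&& w' \in R, w x != a, w x == w' x & w y != w' y]]].
  left=> c d cC dC; have [z zR [zx zy]] := pairsP (row d dC).
  have [z' z'R [z'x z'y]] := pairsP (full_row wR w'R ww' wy dC).
  rewrite pairs_sym -zy; apply: (full_row zR z'R); rewrite ?zy ?z'y //.
  by rewrite zx z'x eq_sym.
rewrite negb_exists => /forallP single.
have [c /setD1P[ca cC]] : exists c, c \in C :\ a.
  by apply/set0Pn; rewrite -card_gt0; move: C_gt1; rewrite (cardsD1 a) aC.
have [w wR wx] := onto x cC; right; exists a, (w y).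
have wyC : w y \in C by apply: valC.
split=> //; split; first exact: row.
move=> z zR; have [->|za] := eqVneq (z x) a; [by left | right].
have [w0 w0R [w0x w0y]] := pairsP (row _ wyC).
have col : pairs R y x (w y) (z x).
  by apply: (full_row wR w0R); rewrite ?w0y ?w0x ?wx ?valC.
have [z' z'R [z'y z'x]] := pairsP col.
move: (single z); rewrite zR /= negb_exists => /forallP/(_ z').
by rewrite z'R za z'x eqxx /= negbK z'y => /eqP.
Qed.

Lemma dual_disc_cases x y :
  [\/ linked R x y, full R C x y
    | exists a b, [/\ a \in C, b \in C & cross x y a b]].
Proof.
have [|] := boolP (linked R x y); first by constructor 1.
rewrite negb_forall_in => /exists_inP[u uR].
rewrite negb_forall_in => /exists_inP[v vR].
have [ux|ux] := eqVneq (u x) (v x); have [uy|uy] := eqVneq (u y) (v y) => // _.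
  by have [] := unlinked_cross uR vR ux uy; [constructor 2 | constructor 3].
have [|[a [b [aC bC [pab crs]]]]] := unlinked_cross uR vR uy ux.
  by constructor 2; apply: full_sym.
constructor 3; exists b, a; split=> //; split; first by rewrite pairs_sym.
by move=> w /crs[]; [right | left].
Qed.

Definition level u a := [set x | u x == a].

Lemma card_level_shift u a x : #|[set g | u (g * x)%g == a]| = #|level u a|.
Proof.
rewrite -[RHS](card_imset _ (@mulIg _ x^-1%g)); apply: eq_card => g.
rewrite inE; apply/idP/imsetP => [ua|[y]]; last by rewrite inE => ua ->; rewrite mulgKV.
by exists (g * x)%g; rewrite ?inE ?mulgK.
Qed.

(** Every translate of [u] satisfies the disjunction in [cross], so translates of the two level sets
    cover the group; they overlap when [u] takes the pair [(a, b)]. *)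
Lemma cross_level x y a b : cross x y a b ->
  (forall u, u \in R -> #|gT| <= #|level u a| + #|level u b|) /\
  exists2 u, u \in R & #|gT| < #|level u a| + #|level u b|.
Proof.
move=> [pab crs].
pose X u := [set g | u (g * x)%g == a]; pose Y u := [set g | u (g * y)%g == b].
have count u : u \in R -> #|level u a| + #|level u b| = #|gT| + #|X u :&: Y u|.
  move=> uR; rewrite -(card_level_shift u a x) -(card_level_shift u b y) -cardsUI -cardsT.
  congr (_ + _); apply: eq_card => g; rewrite !inE.
  by have [] := crs _ (shR g uR); rewrite !ffunE => ->; rewrite eqxx ?orbT.
split=> [u uR|]; first by rewrite count // leq_addr.
have [u uR [ux uy]] := pairsP pab; exists u => //.
rewrite count // -[X in X < _]addn0 ltn_add2l; apply/card_gt0P; exists 1%g.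
by rewrite !inE !mul1g ux uy !eqxx.
Qed.

Lemma disjoint_levels u a b : a != b -> #|level u a| + #|level u b| <= #|gT|.
Proof.
move=> ab; rewrite -cardsUI [X in _ + #|pred_of_set X|](_ : _ = set0) ?cards0 ?addn0 ?max_card //.
apply/setP=> x; rewrite !inE; apply/negbTE/negP=> /andP[/eqP -> /eqP eab].
by rewrite eab eqxx in ab.
Qed.

(* Counting translates, a relation [u x = a \/ u y = b] forces [a = b] and that
   [a] is taken more often than any other value by some member of [R]. *)
Lemma dual_disc_dichotomy :
  has_constant R \/
  (forall x y, linked R x y \/ full R C x y) /\
  (forall (Y : {set gT}) (t : gT -> A),
     {in Y &, forall x y, x != y -> full R C x y} -> (forall y, y \in Y -> t y \in C) ->
     exists2 u, u \in R & forall y, y \in Y -> u y = t y).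
Proof.
have R0 : R != set0.
  have /card_gt0P[a aC] := ltnW C_gt1; have [u uR _] := onto 1%g aC.
  by apply/set0Pn; exists u.
have bp := baker_pixley valC clm mE.
have [/existsP[x /existsP[y /existsP[a /existsP[b /and4P[aC bC pab /forall_inP crs]]]]]|nocross] :=
    boolP [exists x, exists y, exists a, exists b,
      [&& a \in C, b \in C, pairs R x y a b & [forall w in R, (w x == a) || (w y == b)]]].
  have crs' : cross x y a b.
    by split=> // w /crs/orP[] /eqP ->; [left | right].
  have [_ [u0 u0R more]] := cross_level crs'.
  have eab : a = b by apply: contraTeq more => /(disjoint_levels u0); rewrite -leqNgt.
  rewrite -{b bC pab crs crs'}eab addnn in more.
  (* The value [a] fills more than half of [u0], and this yields the pair [(a, a)] at any two
     places: linked coordinates have level sets of equal size, and a cross at another value [c]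
     would make [c] fill at least half of [u0]. *)
  have [u uR ut] : exists2 u, u \in R & forall y, y \in setT -> u y = a.
    apply: (bp (fun=> a)) R0 => x' y' _ _.
    have [lnk|fl|[c [d [cC dC crs]]]] := dual_disc_cases x' y'.
    - have [u uR ux] := onto x' aC; exists u => //; split=> //; apply: contraTeq more => uy.
      rewrite -leqNgt -addnn (_ : #|level u0 a| + _ = #|level u0 a| + #|level u0 (u y')|).
        by apply: disjoint_levels; rewrite eq_sym.
      congr (_ + _); rewrite -(card_level_shift u0 a x') -(card_level_shift u0 (u y') y').
      apply: eq_card => g; rewrite !inE.
      by have := linkedP lnk _ _ (shR g u0R) uR; rewrite !ffunE ux.
    - by have [u uR ?] := pairsP (fl a a aC aC); exists u.
    have [halfc [w wR morec]] := cross_level crs.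
    have ecd : c = d by apply: contraTeq morec => /(disjoint_levels w); rewrite -leqNgt.
    subst d; have [eca|ca] := eqVneq c a.
      by move: crs; rewrite eca => -[/pairsP[u uR ?] _]; exists u.
    have := disjoint_levels u0 ca; have := halfc _ u0R; rewrite addnn => hc hd.
    suff: #|gT|.*2 < (#|level u0 c| + #|level u0 a|).*2 by rewrite ltn_double ltnNge hd.
    by rewrite doubleD -addnn -addnS leq_add.
  by left; exists u => // x1 y1; rewrite !ut ?inE.
right; split=> [x y|Y t indep tC].
  have [|//|[a [b [aC bC [pab crs]]]]] := dual_disc_cases x y; [by left | by right | case/negP: nocross].
  apply/existsP; exists x; apply/existsP; exists y; apply/existsP; exists a; apply/existsP; exists b.
  by rewrite aC bC pab; apply/forall_inP=> w /crs[] ->; rewrite eqxx ?orbT.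
apply: bp => // x y xY yY; have [<-|xy] := eqVneq x y.
  by have [u uR ux] := onto x (tC x xY); exists u.
by have [u uR ?] := pairsP (indep x y xY yY xy _ _ (tC x xY) (tC y yY)); exists u.
Qed.

End DualDiscriminator.

Lemma pairs_closed R x y k p : closed_op k p R -> closed_rel k p (pairs R x y).
Proof.
move=> clR l sz Pl; suff [us [szu usR <- <-]] : exists us : seq vec,
    [/\ size us = size l, {subset us <= R}, [seq u x | u : vec <- us] = unzip1 l
      & [seq u y | u : vec <- us] = unzip2 l].
  apply/pairsP; exists (lift p us); first by apply: clR; rewrite ?szu.
  by rewrite !ffunE.
elim: l Pl {sz} => [|[a b] l IH] /= => [_|/andP[/pairsP[u uR [ua ub]] /IH[us [szu usR ex ey]]]].
  by exists [::].
exists (u :: us); rewrite /= szu ex ey ua ub; split=> //.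
by move=> w; rewrite inE => /predU1P[->|/usR].
Qed.

Definition fiber R x a := [set u in R | u x == a].

Lemma fiber_closed R x a k p :
  closed_op k p R -> p (nseq k a) = a -> closed_op k p (fiber R x a).
Proof.
move=> clR pa us sz usR; rewrite inE clR //=; last by move=> u /usR; rewrite inE => /andP[].
rewrite ffunE (_ : map _ us = nseq k a) ?pa //.
rewrite -sz -(size_map (fun u : vec => u x)); apply/all_pred1P/allP => _ /mapP[u /usR + ->].
by rewrite inE => /andP[_].
Qed.

(** * Independence of pairwise unlinked coordinates *)

Section Freeness.

Variables (Ops : nat -> (seq A -> A) -> Prop) (C : {set A}).
Variables (s : A -> A -> A) (q : seq A -> A).

Definition stable R := forall k p, Ops k p -> closed_op k p R.
Definition stable_rel (P : rel A) := forall k p, Ops k p -> closed_rel k p P.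
Definition injective_rel (P : rel A) :=
  forall a b a' b', P a b -> P a' b' -> (a == a') = (b == b').

(** An operation of arity [#|C|.+1]. Its tail can be constant at one place and exhaust [C] at
    others, where the symmetric [q] then always returns the same value. *)
Definition twist (l : seq A) := if l is z :: us then s (q us) z else q l.

Hypothesis C_gt1 : 1 < #|C|.
Hypothesis idem : forall k p a, Ops k p -> a \in C -> p (nseq k a) = a.
Hypothesis rectangular : forall P : rel A, stable_rel P ->
  (forall a b, P a b -> a \in C /\ b \in C) ->
  (forall a, a \in C -> exists b, P a b) -> (forall b, b \in C -> exists a, P a b) ->
  {in C &, forall a b, P a b} \/ injective_rel P.
Hypothesis Ops_twist : Ops #|C|.+1 twist.
Hypothesis q_idem : forall a, a \in C -> q (nseq #|C| a) = a.
Hypothesis q_sym : forall l l', size l = #|C| -> perm_eq l l' -> q l = q l'.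
Hypothesis sC : {in C &, commutative s}.
Hypothesis s_idem : forall a, a \in C -> s a a = a.

Let C_gt0 : 0 < #|C|. Proof. exact: ltnW. Qed.

Lemma rectangular_pairs R x y : stable R -> (forall u z, u \in R -> u z \in C) ->
    (forall a, a \in C -> exists b, pairs R x y a b) ->
    (forall b, b \in C -> exists a, pairs R x y a b) ->
  full R C x y \/ injective_rel (pairs R x y).
Proof.
move=> stR RC sl sr.
have st : stable_rel (pairs R x y) by move=> k p pO; apply/pairs_closed/stR.
have val a b : pairs R x y a b -> a \in C /\ b \in C.
  by case/pairsP=> u uR [<- <-]; split; apply: RC.
by have [H|] := rectangular st val sl sr; [left=> a b; apply: H | right].
Qed.

Section Triple.

Variables (R : {set vec}) (x y z : gT).
Hypotheses (stR : stable R) (RC : forall u z, u \in R -> u z \in C).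
Hypotheses (fxy : full R C x y) (fyz : full R C y z) (fxz : full R C x z).

(** Idempotence makes the fiber stable, and fullness at [(i, j)] and [(i, k)] makes its projection
    to [j], [k] subdirect. *)
Lemma fiber_full_or_inj i j k a : a \in C ->
    full R C i j -> full R C i k ->
  full (fiber R i a) C j k \/ injective_rel (pairs (fiber R i a) j k).
Proof.
move=> aC fij fik; apply: rectangular_pairs.
- by move=> n p pO; apply: fiber_closed (stR pO) (idem pO aC).
- by move=> u l; rewrite inE => /andP[uR _]; apply: RC.
- move=> b bC; have [u uR [ui uj]] := pairsP (fij a b aC bC).
  by exists (u k); apply/pairsP; exists u; rewrite // inE uR ui eqxx.
move=> b bC; have [u uR [ui uj]] := pairsP (fik a b aC bC).
by exists (u j); apply/pairsP; exists u; rewrite // inE uR ui eqxx.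
Qed.

Lemma fiberP i a u : reflect (u \in R /\ u i = a) (u \in fiber R i a).
Proof. by rewrite inE; apply: (iffP andP) => -[? /eqP]. Qed.

(* Otherwise each coordinate of [R] at [x], [y], [z] is a function of the two
   others; then [twist] applied to members whose entry at [x] is [a] and whose
   entries at [y], resp. [z], exhaust [C] shows that [s a b] does not depend on
   [a]. *)
Lemma triple_full a b c : a \in C -> b \in C -> c \in C ->
  exists2 u, u \in R & [/\ u x = a, u y = b & u z = c].
Proof.
move=> aC bC cC.
have fyx : full R C y x by apply: full_sym.
have [fl|injx] := fiber_full_or_inj aC fxy fxz.
  by have [u /fiberP[uR ua] [ub uc]] := pairsP (fl b c bC cC); exists u.
exfalso.
have [b0 [b1 [b0C b1C b01]]] : exists b0 b1, [/\ b0 \in C, b1 \in C & b0 != b1].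
  by have /card_gt1P := C_gt1.
(* A full fiber over [d] at [y] has two members with entry [a] at [x] and different entries at [z],
   against [injx]. *)
have injy d : d \in C -> injective_rel (pairs (fiber R y d) x z).
  move=> dC; have [fl|//] := fiber_full_or_inj dC fyx fyz.
  have [u0 /fiberP[u0R u0d] [u0a u0b]] := pairsP (fl a b0 aC b0C).
  have [u1 /fiberP[u1R u1d] [u1a u1b]] := pairsP (fl a b1 aC b1C).
  have := injx d b0 d b1; rewrite eqxx (negPf b01) => H; suff : true = false by [].
  apply: H; apply/pairsP.
    by exists u0; [apply/fiberP | rewrite u0d u0b].
  by exists u1; [apply/fiberP | rewrite u1d u1b].
have injxC d : d \in C -> injective_rel (pairs (fiber R x d) y z).
  move=> dC; have [fl|//] := fiber_full_or_inj dC fxy fxz.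
  have [u0 /fiberP[u0R u0d] [u0a u0b]] := pairsP (fl a b0 aC b0C).
  have [u1 /fiberP[u1R u1d] [u1a u1b]] := pairsP (fl a b1 aC b1C).
  have := injy a aC d b0 d b1; rewrite eqxx (negPf b01) => H; suff : true = false by [].
  apply: H; apply/pairsP.
    by exists u0; [apply/fiberP | rewrite u0d u0b].
  by exists u1; [apply/fiberP | rewrite u1d u1b].
pose row d e := odflt [ffun=> a] [pick u in R | (u x == d) && (u y == e)].
have rowP d e : d \in C -> e \in C -> [/\ row d e \in R, row d e x = d & row d e y = e].
  move=> dC eC; rewrite /row; case: pickP => [u /and3P[uR /eqP ux /eqP uy] //|].
  have [u uR [ux uy]] := pairsP (fxy dC eC).
  by move=> /(_ u); rewrite uR ux uy !eqxx.
pose tw d u := lift twist (u :: [seq row d e | e in C]).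
have twR d u : d \in C -> u \in R -> tw d u \in R.
  move=> dC uR; apply: (stR Ops_twist); first by rewrite /= size_map -cardE.
  move=> w; rewrite inE => /predU1P[-> //|/mapP[e]]; rewrite mem_enum => eC ->.
  by have [] := rowP d e.
have twx d u : d \in C -> tw d u x = s d (u x).
  move=> dC; rewrite ffunE /= -map_comp.
  rewrite (_ : map _ _ = nseq #|C| d) ?q_idem // cardE.
  have -> : nseq (size (enum C)) d = [seq d | _ <- enum C] by elim: (enum C) => //= ? ? ->.
  by apply/eq_in_map => e; rewrite mem_enum => eC /=; have [] := rowP d e.
pose k := q (enum C).
have twy d u : d \in C -> tw d u y = s k (u y).
  move=> dC; rewrite ffunE /= -map_comp; congr (s (q _) _).
  by rewrite -[RHS]map_id; apply/eq_in_map => e; rewrite mem_enum => eC; have [] := rowP d e.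
(* By [injxC] the entries of the [row d e] at [z] also run through all of [C]. *)
have twz d u : d \in C -> tw d u z = s k (u z).
  move=> dC; rewrite ffunE /= -map_comp; congr (s _ _); apply: q_sym; first by rewrite size_map -cardE.
  apply: perm_enum_image => [e e' eC e'C /eqP|e eC]; last by apply: RC; have [] := rowP d e.
  have [[r1 r2 r3] [r1' r2' r3']] := (rowP d e dC eC, rowP d e' dC e'C).
  rewrite -(injxC d dC e _ e'); first by move/eqP.
    by apply/pairsP; exists (row d e); first apply/fiberP.
  by apply/pairsP; exists (row d e'); first apply/fiberP.
(* For [v] with entry [e] at [x], the members [tw d v] and [tw e v] agree at [y] and [z], hence at
   [x], where they are [s d e] and [s e e]. *)
have s2 d e : d \in C -> e \in C -> s d e = e.
  move=> dC eC; have [v vR [vx _]] := pairsP (fxy eC eC).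
  have := injy _ (RC y (twR d v dC vR)) (tw d v x) (tw d v z) (tw e v x) (tw e v z).
  rewrite !twx // !twz // vx s_idem // eqxx => H; apply/eqP; rewrite H //; apply/pairsP.
    by exists (tw d v); [apply/fiberP; split=> //; apply: twR | rewrite twx // twz // vx].
  exists (tw e v); [apply/fiberP; split=> //; first exact: twR |
    by rewrite twx // twz // vx s_idem].
  by rewrite !twy.
by case/eqP: b01; rewrite -(s2 b1 b0) // sC // s2.
Qed.

End Triple.
(** Prescribing the entries on [Y] minus three places leaves a stable set [RZ], by idempotence. The
    induction hypotheses make [RZ] full at each two of the three places, and [triple_full] then
    fills in all of them. *)
Lemma rectangular_free R (Y : {set gT}) (t : gT -> A) :
    stable R -> (forall u z, u \in R -> u z \in C) -> R != set0 ->
    (forall x a, a \in C -> exists2 u, u \in R & u x = a) ->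
    {in Y &, forall x y, x != y -> full R C x y} ->
    (forall y, y \in Y -> t y \in C) ->
  exists2 u, u \in R & forall y, y \in Y -> u y = t y.
Proof.
move=> stR RC /set0Pn[u0 u0R] onto; elim/set_three_ind: Y t.
- by move=> t _ _; exists u0 => // y; rewrite inE.
- move=> x y t indep tC; have [[xC yC]] := (tC _ (set21 x y), tC _ (set22 x y)).
  have [xy|xy] := eqVneq x y.
    have [u uR ux] := onto x _ xC; exists u => // z; rewrite -xy => /set2P[] -> //.
  have [u uR [ux uy]] := pairsP (indep _ _ (set21 x y) (set22 x y) xy _ _ xC yC).
  by exists u => // z /set2P[] ->.
move=> Y x y z xY yY zY xy yz zx IHx IHy IHz t indep tC.
pose Z := Y :\ x :\ y :\ z.
pose RZ := [set u in R | [forall c in Z, u c == t c]].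
have RZP u : reflect (u \in R /\ forall c, c \in Z -> u c = t c) (u \in RZ).
  rewrite inE; apply: (iffP andP) => -[uR uZ]; split=> //; first by move=> w /(forall_inP uZ)/eqP.
  by apply/forall_inP=> w /uZ ->.
have ZP (w : gT) : (w \in Z) = [&& w != x, w != y, w != z & w \in Y].
  by rewrite !inE; do !bool_congr.
have stZ : stable RZ.
  move=> k p pO us sz usR; apply/RZP; split.
    by apply: (stR _ _ pO us sz) => u /usR/RZP[].
  move=> w wZ; rewrite ffunE (_ : map _ us = nseq k (t w)).
    by apply: (idem pO); apply: tC; move: wZ; rewrite ZP => /and4P[].
  rewrite -sz -(size_map (fun u : vec => u w)); apply/all_pred1P/allP => _ /mapP[u /usR + ->].
  by case/RZP=> _ /(_ w wZ) /= ->.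
have ins (c a b : gT) : [/\ a \in Y :\ c, b \in Y :\ c, a != b & forall d : gT, d \in Y :\ c ->
      [\/ d = a, d = b | d \in Z]] -> a \notin Z -> b \notin Z -> Z \subset Y :\ c ->
    (forall t0 : gT -> A, {in Y :\ c &, forall x y, x != y -> full R C x y} ->
       (forall y, y \in Y :\ c -> t0 y \in C) ->
       exists2 u, u \in R & forall y, y \in Y :\ c -> u y = t0 y) ->
    full RZ C a b.
  move=> [aY bY ab cover] aZ bZ ZY IH d e dC eC; pose t0 := [eta t with a |-> d, b |-> e].
  have [||u uR ut] := IH t0.
  - by move=> v w /setD1P[_ vY] /setD1P[_ wY]; apply: indep.
  - by move=> w /setD1P[_ wY] /=; do 2?case: ifP => // _; apply: tC.
  apply/pairsP; exists u; last by rewrite !ut //= eqxx eq_sym (negPf ab) eqxx.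
  apply/RZP; split=> // w wZ; rewrite ut ?(subsetP ZY) //=.
  by case: eqP => [ewa|_]; [rewrite -ewa wZ in aZ | case: eqP => // ewb; rewrite -ewb wZ in bZ].
have ZS c : c \in [:: x; y; z] -> Z \subset Y :\ c.
  move=> c3; apply/subsetP=> w; rewrite ZP => /and4P[wx wy wz wY]; rewrite !inE wY andbT.
  by move: c3; rewrite !inE => /or3P[] /eqP ->.
have fxy : full RZ C x y.
  apply: (ins z) IHz; rewrite ?ZS ?ZP ?inE ?eqxx ?orbT ?andbF //; split=> //.
  - by rewrite eq_sym zx.
  - by rewrite yz.
  move=> w /setD1P[wz wY].
  case: (eqVneq w x) => [|wx]; first by constructor 1.
  case: (eqVneq w y) => [|wy]; first by constructor 2.
  by constructor 3; rewrite ZP wx wy wz.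
have fyz : full RZ C y z.
  apply: (ins x) IHx; rewrite ?ZS ?ZP ?inE ?eqxx ?orbT ?andbF //; split=> //.
  - by rewrite eq_sym xy.
  - by rewrite zx.
  move=> w /setD1P[wx wY].
  case: (eqVneq w y) => [|wy]; first by constructor 1.
  case: (eqVneq w z) => [|wz]; first by constructor 2.
  by constructor 3; rewrite ZP wx wy wz.
have fxz : full RZ C x z.
  apply: (ins y) IHy; rewrite ?ZS ?ZP ?inE ?eqxx ?orbT ?andbF //; split=> //.
  - by rewrite xy.
  - by rewrite eq_sym yz.
  - by rewrite eq_sym.
  move=> w /setD1P[wy wY].
  case: (eqVneq w x) => [|wx]; first by constructor 1.
  case: (eqVneq w z) => [|wz]; first by constructor 2.
  by constructor 3; rewrite ZP wx wy wz.
have RZC u (w : gT) : u \in RZ -> u w \in C by case/RZP=> uR _; apply: RC.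
have [u /RZP[uR uZ] [ux uy uz]] := triple_full stZ RZC fxy fyz fxz (tC x xY) (tC y yY) (tC z zY).
exists u => // w wY; case: (eqVneq w x) => [-> //|wx]; case: (eqVneq w y) => [-> //|wy].
by case: (eqVneq w z) => [-> //|wz]; rewrite uZ // ZP wx wy wz.
Qed.

Lemma rectangular_sections R :
    stable R -> shift_closed R -> values R = C ->
  exists sg : A -> vec,
    (forall a, a \in C -> sg a \in R) /\ (forall x, {in C &, injective (fun a => sg a x)}).
Proof.
move=> stR shR valR.
have RC u x : u \in R -> u x \in C.
  by move=> uR; rewrite -valR; apply/valuesP => //; exists u.
have onto x a : a \in C -> exists2 u, u \in R & u x = a.
  by rewrite -valR => /valuesP; apply.
have R0 : R != set0.
  by have /card_gt0P[a /(onto 1%g)[u uR _]] := C_gt0; apply/set0Pn; exists u.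
apply: (disjoint_sections (C := C)) => [x y|Y t indep tC]; last exact: rectangular_free.
have [a aC|b bC|fl|inj] := @rectangular_pairs R x y stR RC; last 2 first.
- by right.
- left; apply/linkedP => u v uR vR; apply: inj; apply/pairsP; first by exists u.
  by exists v.
- by have [u uR ux] := onto x a aC; exists (u y); apply/pairsP; exists u.
by have [u uR uy] := onto y b bC; exists (u x); apply/pairsP; exists u.
Qed.

End Freeness.

(** * The outcomes of the classification *)

Section Classified.

Variable s : A -> A -> A.

Definition subalgebra_rel C (P : rel A) :=
  [/\ forall a b a' b', P a b -> P a' b' -> P (s a a') (s b b'),
      forall a b, P a b -> a \in C /\ b \in C,
      forall a, a \in C -> exists b, P a b & forall b, b \in C -> exists a, P a b].

(** As a bipartite graph [P] is disconnected: [B] is a union of left sides of components, neither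
    empty nor everything. *)
Definition splits (P : rel A) (B : {set A}) :=
  [/\ B != set0, B != setT & forall a a' b, P a b -> P a' b -> (a \in B) = (a' \in B)].

(** In the first case the halfway set [D] frees the moves of the first stage from keeping [[set a]].
    The last case offers [splits] instead of a bijection because simplicity is available only for
    the whole family of symmetric operations, not for [s] alone. *)
Inductive classified : Prop :=
  | ClassifiedConst D a of step s setT D & step s D [set a]
  | ClassifiedDisc C m of step s setT C & #|C| <= 3 & m = maj1 s \/ m = maj2 s
      & (forall a b c, a \in C -> b \in C -> c \in C -> m a b c = if b == c then b else a)
  | ClassifiedIdeal C of step s setT C & #|C| = 3 & (forall x y, y \in C -> s x y \in C)
      & (forall P, subalgebra_rel C P -> {in C &, forall a b, P a b} \/ injective_rel P)
  | ClassifiedFull of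
      (forall P, subalgebra_rel setT P -> (forall a b, P a b) \/ exists B, splits P B).

End Classified.

Lemma closed_maj s R m u v w : closed2 s R -> m = maj1 s \/ m = maj2 s ->
  u \in R -> v \in R -> w \in R -> [ffun x => m (u x) (v x) (w x)] \in R.
Proof.
move=> cls; pose L := lift2 s; pose L2 := lift2 (rmul2 s); pose L3 := lift2 (rmul3 s).
have c1 u' v' : u' \in R -> v' \in R -> L u' v' \in R by apply: cls.
have c2 u' v' : u' \in R -> v' \in R -> L2 u' v' \in R by apply: closed_rmul2.
have c3 u' v' : u' \in R -> v' \in R -> L3 u' v' \in R by apply: closed_rmul3.
move=> [] -> uR vR wR.
  rewrite (_ : finfun _ = L3 u (L3 v (L (L (L2 (L v w) u) (L2 (L u w) v)) (L2 (L u v) w)))).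
    by do !first [apply: (c3) | apply: (c2) | apply: (c1)].
  by apply/ffunP=> x; rewrite !ffunE.
rewrite (_ : finfun _ = L3 u (L (L (L u v) w) (L (L v w) u))).
  by do !first [apply: (c3) | apply: (c1)].
by apply/ffunP=> x; rewrite !ffunE.
Qed.

(** One function on sequences stands for the idempotent symmetric operations of all arities up to
    [#|A|]; the length is the arity. *)
Definition symmetric_family (sy : seq A -> A) :=
  (forall k a, 0 < k <= #|A| -> sy (nseq k a) = a) /\
  (forall l l', 0 < size l <= #|A| -> perm_eq l l' -> sy l = sy l').

Definition congruence (sy : seq A -> A) (E : rel A) :=
  equivalence_rel E /\ forall k, 0 < k <= #|A| -> closed_rel k sy E.

(** * Congruences from disconnected relations *)

Section Congruence.

Variables (sy : seq A -> A) (B : {set A}).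

(** The last clause keeps the congruence generated by [Q] proper. *)
Definition tolerance (Q : rel A) :=
  [/\ reflexive Q, symmetric Q, forall k, 0 < k <= #|A| -> closed_rel k sy Q
    & forall a b, Q a b -> (a \in B) = (b \in B)].

Definition compose (Q : rel A) : rel A := fun a c => [exists b, Q a b && Q b c].

Lemma compose_closed k (P Q S : rel A) :
  (forall a c, S a c -> exists b, P a b /\ Q b c) ->
  (forall a b c, P a b -> Q b c -> S a c) ->
  closed_rel k sy P -> closed_rel k sy Q -> closed_rel k sy S.
Proof.
move=> SPQ PQS clP clQ l sz Sl.
suff [m [szm Pm Qm]] : exists m, [/\ size m = size l,
    all (fun q => P q.1 q.2) (zip (unzip1 l) m) & all (fun q => Q q.1 q.2) (zip m (unzip2 l))].
  have sz1 : size (unzip1 l) = size m by rewrite size_map.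
  have sz2 : size m = size (unzip2 l) by rewrite size_map.
  apply: (PQS _ (sy m)).
    have := clP (zip (unzip1 l) m); rewrite unzip1_zip ?sz1 // unzip2_zip ?sz1 //; apply=> //.
    by rewrite size_zip sz1 minnn szm.
  have := clQ (zip m (unzip2 l)); rewrite unzip1_zip -?sz2 // unzip2_zip -?sz2 //; apply=> //.
  by rewrite size_zip -sz2 minnn szm.
elim: l Sl {sz} => [|[a c] l IH] /= => [_|/andP[/SPQ[b [Pab Qbc]] /IH[m [szm Pm Qm]]]].
  by exists [::].
by exists (b :: m); rewrite /= szm Pab Pm Qbc Qm.
Qed.

Lemma compose_tolerance Q : tolerance Q -> tolerance (compose Q).
Proof.
move=> [rfl sym cl resp]; split.
- by move=> a; apply/existsP; exists a; rewrite rfl.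
- by move=> a c; apply/existsP/existsP => -[b /andP[H1 H2]]; exists b; rewrite sym H2 sym H1.
- move=> k kA; apply: (@compose_closed k Q Q) (cl k kA) (cl k kA).
    by move=> a c /existsP[b /andP[]]; exists b.
  by move=> a b c ab bc; apply/existsP; exists b; rewrite ab.
by move=> a c /existsP[b /andP[/resp -> /resp]].
Qed.

(** Each iterate is the square of the previous one. The graphs grow strictly inside the finite
    [A * A] until one is transitive. *)
Lemma tolerance_congruence Q : tolerance Q ->
  exists E, [/\ congruence sy E, subrel Q E & forall a b, E a b -> (a \in B) = (b \in B)].
Proof.
move=> tolQ; pose graph (P : rel A) := [set p | P p.1 p.2].
pose Qk k := iter k compose Q.
have tolk k : tolerance (Qk k) by elim: k => //= k IH; apply: compose_tolerance.
have sub1 k : subrel (Qk k) (Qk k.+1).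
  by move=> a b ab; apply/existsP; exists b; apply/andP; split=> //; case: (tolk k) => rfl _ _ _; apply: rfl.
have subk k : subrel Q (Qk k) by elim: k => // k IH a b /IH; apply: sub1.
have stab k : (exists j, transitive (Qk j)) \/ k <= #|graph (Qk k)|.
  elim: k => [|k [|IH]]; [by right | by left |].
  have [tr|] := boolP [forall a, forall b, forall c, Qk k a b ==> (Qk k b c ==> Qk k a c)].
    left; exists k => b a c ab bc; move/forallP: tr => /(_ a)/forallP/(_ b)/forallP/(_ c).
    by move=> /implyP/(_ ab)/implyP/(_ bc).
  rewrite negb_forall => /existsP[a]; rewrite negb_forall => /existsP[b].
  rewrite negb_forall => /existsP[c]; rewrite !negb_imply => /and3P[ab bc ac].
  right; apply: leq_ltn_trans IH _; apply: proper_card; apply/properP; split.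
    by apply/subsetP=> p; rewrite !inE; apply: sub1.
  by exists (a, c); rewrite !inE //=; apply/existsP; exists b; apply/andP.
have [[j tr]|] := stab #|{: A * A}|.+1; last by rewrite ltnNge max_card.
have [rfl sym cl resp] := tolk j; exists (Qk j); split; [split=> // | exact: subk | exact: resp].
by apply/equivalence_relP; split=> // a b ab; apply/sym_left_transitive.
Qed.

(** Having a common right neighbour is a tolerance [e]. If it relates distinct elements, the
    congruence it generates is nontrivial, and it is proper because it respects [B]. *)
Lemma split_congruence P : (forall k, 0 < k <= #|A| -> closed_rel k sy P) ->
    (forall a, exists b, P a b) -> (forall b, exists a, P a b) -> splits P B ->
    (forall a b, a != b -> ~~ ([exists c, P a c && P b c])) \/
  exists E, [/\ congruence sy E, exists a b, a != b /\ E a b & exists a b, ~~ E a b].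
Proof.
move=> clP sl sr [B0 BT resp].
pose e : rel A := fun a b => [exists c, P a c && P b c].
have tole : tolerance e.
  split.
  - by move=> a; have [b Pab] := sl a; apply/existsP; exists b; rewrite Pab.
  - by move=> a b; apply/existsP/existsP => -[c]; exists c; rewrite andbC.
  - move=> k kA; apply: (@compose_closed k P (fun b a => P a b)) (clP k kA) _.
    + by move=> a b /existsP[c /andP[]]; exists c.
    + by move=> a c b ac bc; apply/existsP; exists c; rewrite ac.
    move=> l sz Pl; have := clP k kA [seq (q.2, q.1) | q <- l].
    rewrite size_map all_map /unzip1 /unzip2 -!map_comp; apply=> //; exact: Pl.
  by move=> a b /existsP[c /andP[]]; apply: resp.
have [E [congE eE respE]] := tolerance_congruence tole.
have [/existsP[a /existsP[b /andP[ab eab]]]|] := boolP [exists a, exists b, (a != b) && e a b].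
  right; exists E; split=> //; first by exists a, b; split=> //; apply: eE.
  have /set0Pn[c cB] := B0; have [d dB] : exists d, d \notin B.
    by apply/existsP; rewrite -negb_forall; apply: contraNN BT => /forallP BT;
      apply/eqP/setP => d; rewrite BT inE.
  by exists c, d; apply: contraNN dB => /respE <-.
rewrite negb_exists => /forallP H; left=> a b ab.
by move: (H a); rewrite negb_exists => /forallP/(_ b); rewrite ab.
Qed.

(** Left neighbours are unique and define a map [h] onto [A], which is injective by finiteness. *)
Lemma injective_of_unlinked (P : rel A) :
  (forall a, exists b, P a b) -> (forall b, exists a, P a b) ->
  (forall a b, a != b -> ~~ ([exists c, P a c && P b c])) -> injective_rel P.
Proof.
move=> sl sr unl.
have col a a' b : P a b -> P a' b -> a = a'.
  move=> Pab Pa'b; apply/eqP/contraT => /unl/existsP[]; by exists b; rewrite Pab.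
pose h b := odflt b [pick a | P a b].
have hP b : P (h b) b.
  by rewrite /h; case: pickP => // no; have [a] := sr b; rewrite no.
have himg : codom h =i predT.
  by move=> a; have [b Pab] := sl a; rewrite inE; apply/codomP; exists b; apply: col Pab (hP b).
have hI : injective h.
  apply/injectiveP; rewrite /injectiveb /dinjectiveb; apply/card_uniqP.
  by rewrite size_map -cardE; apply: eq_card => a; rewrite himg.
move=> a b a' b' Pab Pa'b'; apply/eqP/eqP => [eaa|ebb].
  by apply: hI; rewrite (col _ _ _ (hP b) Pab) (col _ _ _ (hP b') Pa'b').
by rewrite ebb in Pab; apply: col Pab Pa'b'.
Qed.

End Congruence.

(** * A constant in each outcome *)

Section Core.

Variables (sy : seq A -> A) (R : {set vec}).
Let s x y := sy [:: x; y].

Hypothesis sySym : symmetric_family sy.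
Hypotheses (A_gt1 : 1 < #|A|) (shR : shift_closed R).
Hypothesis stR : forall k, 0 < k <= #|A| -> closed_op k sy R.

Lemma family2_idem a : s a a = a.
Proof. exact: (proj1 sySym 2). Qed.

Lemma family2C : commutative s.
Proof.
by move=> x y; apply: (proj2 sySym) => //; rewrite (perm_catC [:: x] [:: y]).
Qed.

Lemma family2_closed : closed2 s R.
Proof.
move=> u v uR vR; suff -> : lift2 s u v = lift sy [:: u; v].
  apply: (stR (k := 2)) => // w; by rewrite !inE => /orP[] /eqP ->.
by apply/ffunP=> x; rewrite !ffunE.
Qed.

(** On the two values [s] is a semilattice with [a] absorbing, so a member with the most entries [a]
    can be improved as long as it has another entry. *)
Lemma constant_two R' a b : shift_closed R' -> closed2 s R' ->
  R' \subset R -> values R' = [set a; b] -> s a b = a -> has_constant R.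
Proof.
move=> shR' clR' /subsetP subR valR' sab.
have ab u x : u \in R' -> u x = a \/ u x = b.
  by move=> uR; apply/set2P; rewrite -valR'; apply/valuesP => //; exists u.
have [u0 u0R _] : exists2 u, u \in R' & u 1%g = a.
  by apply/valuesP => //; rewrite valR' set21.
pose N u := [set x | u x == a].
case: (@arg_maxnP _ u0 (mem R') (fun u => #|N u|) u0R) => u /= uR maxu.
exists u; first exact: subR.
suff ua x : u x = a by move=> x y; rewrite !ua.
apply/eqP/contraT => ux; have [v vR vx] : exists2 v, v \in R' & v x = a.
  by apply/valuesP => //; rewrite valR' set21.
suff: #|N u| < #|N (lift2 s v u)| by rewrite ltnNge maxu //; apply: clR'.
apply: proper_card; apply/properP; split.
  apply/subsetP=> y; rewrite !inE ffunE => /eqP ->.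
  by have [-> | ->] := ab v y vR; rewrite ?family2_idem // family2C sab.
exists x; rewrite !inE // ffunE vx; have [uxa|->] := ab u x uR; last by rewrite sab.
by rewrite uxa eqxx in ux.
Qed.

Lemma sections_family R' C :
    R' \subset R -> 0 < #|C| -> (forall u x, u \in R' -> u x \in C) ->
    (exists sg : A -> vec, (forall a, a \in C -> sg a \in R') /\
       (forall x, {in C &, injective (fun a => sg a x)})) ->
  has_constant R.
Proof.
move=> /subsetP subR C0 R'C [sg [sgR sgI]].
have Cle : 0 < #|C| <= #|A| by rewrite C0 max_card.
apply: (sections_constant (C := C) (p := sy) (sg := sg)) => //.
- exact: stR.
- by move=> l l' sz; apply: (proj2 sySym); rewrite sz.
- by move=> a aC; apply/subR/sgR.
by move=> a x aC; apply: R'C; apply: sgR.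
Qed.

(** [C] is an ideal only for [s], and the symmetric operation of arity three may leave it; [twist]
    multiplies the result by an argument from [C], which leads back into [C]. If some value of [C]
    does not occur, at most two do, and [s] is a semilattice on them. *)
Lemma ideal_constant C : step s setT C -> #|C| = 3 -> values R = setT ->
    (forall x y, y \in C -> s x y \in C) ->
    (forall P, subalgebra_rel s C P -> {in C &, forall a b, P a b} \/ injective_rel P) ->
  has_constant R.
Proof.
move=> stC C3 valR sC rect; pose R' := restrict R C.
have R'R : R' \subset R by apply/subsetP=> u /restrictP[].
have R'C u x : u \in R' -> u x \in C by case/restrictP.
have shR' : shift_closed R' by apply: restrict_shift.
have clR' : closed2 s R'.
  move=> u v /restrictP[uR uC] /restrictP[vR vC]; apply/restrictP.
  by split; [apply: family2_closed | move=> x; rewrite ffunE; apply: sC].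
have R'0 : R' != set0.
  apply: (step_restrict family2_closed shR valR stC).
  (* [sy [::]] just names some element of [A]. *)
  have /imsetP[u uR _] : (sy [::]) \in values R by rewrite valR inE.
  by apply/set0Pn; exists u; apply/restrictP; split=> // x; rewrite inE.
have [valC|valC] := eqVneq (values R') C.
  pose Ops k p := k = 2 /\ p = sy \/ k = #|C|.+1 /\ p = twist s sy.
  have C_le : 0 < #|C| <= #|A| by rewrite max_card C3.
  have C_gt1 : 1 < #|C| by rewrite C3.
  apply: (sections_family R'R (C := C)) => //; first by rewrite C3.
  apply: (rectangular_sections (Ops := Ops) (s := s) (q := sy)) => //.
  - move=> k p a [] [-> ->] aC; first exact: (proj1 sySym 2).
    by rewrite /twist /= (proj1 sySym) // family2_idem.
  - move=> P stP PC sl sr; apply: rect; split=> // a b a' b' Pab Pab'.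
    by apply: (stP 2 sy _ [:: (a, b); (a', b')]); [left | | rewrite /= Pab Pab'].
  - by right.
  - by move=> a aC; apply: (proj1 sySym).
  - by move=> l l' sz; apply: (proj2 sySym); rewrite sz.
  - by move=> a b _ _; apply: family2C.
  - by move=> a _; apply: family2_idem.
  move=> k p [] [-> ->] us sz usR'.
    case: us sz usR' => [|u [|v []]] // _ uR'.
    rewrite (_ : lift sy _ = lift2 s u v); first by apply: clR'; apply: uR'; rewrite !inE eqxx ?orbT.
    by apply/ffunP=> x; rewrite !ffunE.
  case: us sz usR' => [|u us] // [sz] usR'.
  rewrite (_ : lift _ _ = lift2 s (lift sy us) u); last by apply/ffunP=> x; rewrite !ffunE.
  have uR' : u \in R' by apply: usR'; rewrite inE eqxx.
  apply/restrictP; split; last by move=> x; rewrite ffunE sC // R'C.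
  apply: family2_closed; last exact: (subsetP R'R).
  apply: (stR (k := #|C|)) => // v vus; apply: (subsetP R'R); apply: usR'.
  by rewrite inE vus orbT.
have [u uR'] := set0Pn _ R'0.
have uv v x : v \in R' -> v x \in values R' by move=> vR; apply/valuesP => //; exists v.
have leval : #|values R'| < 3.
  by rewrite -C3; apply: proper_card; rewrite properEneq valC values_restrict.
have [x0 vx0] : exists x, x \in values R' by exists (u 1%g); apply: (uv u 1%g).
have [v1|/set0Pn[b /setD1P[bx0 vb]]] := eqVneq (values R' :\ x0) set0.
  exists u; first exact: (subsetP R'R).
  have eqx0 x : u x = x0.
    by apply/eqP; move: (in_set0 (u x)); rewrite -v1 !inE uv // andbT => /negbFE.
  by move=> x y; rewrite !eqx0.
have val2 : values R' = [set x0; b].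
  apply/esym/eqP; rewrite eqEcard subUset !sub1set vx0 vb cards2 eq_sym bx0 /=.
  by rewrite -ltnS.
have sab : s x0 b \in values R'.
  have [v vR' vx] := valuesP 1%g x0 shR' vx0; have [w wR' wb] := valuesP 1%g b shR' vb.
  by have := uv _ 1%g (clR' _ _ vR' wR'); rewrite ffunE vx wb.
move: sab; rewrite val2 => /set2P[]; first exact: constant_two val2.
by rewrite family2C => H; apply: (constant_two shR' clR' R'R (a := b) (b := x0)); rewrite // setUC.
Qed.

(** The dual discriminator returns one of its arguments, so the restriction to [C] is closed under
    [m], and [C] can be shrunk to the values that occur. *)
Lemma disc_constant C m : step s setT C -> #|C| <= 3 -> values R = setT ->
    m = maj1 s \/ m = maj2 s ->
    (forall a b c, a \in C -> b \in C -> c \in C -> m a b c = if b == c then b else a) ->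
  has_constant R.
Proof.
move=> stC C3 valR mm mE; pose R' := restrict R C.
have R'R : R' \subset R by apply/subsetP=> u /restrictP[].
have R'C u x : u \in R' -> u x \in C by case/restrictP.
have shR' : shift_closed R' by apply: restrict_shift.
have clm u v w : u \in R' -> v \in R' -> w \in R' -> [ffun x => m (u x) (v x) (w x)] \in R'.
  move=> uR vR wR; apply/restrictP; split.
    by apply: (closed_maj family2_closed mm); apply: (subsetP R'R).
  by move=> x; rewrite ffunE mE ?R'C //; case: ifP; rewrite R'C.
have R'0 : R' != set0.
  apply: (step_restrict family2_closed shR valR stC).
  have /imsetP[u uR _] : (sy [::]) \in values R by rewrite valR inE.
  by apply/set0Pn; exists u; apply/restrictP; split=> // x; rewrite inE.
have [u uR'] := set0Pn _ R'0.
have uv v x : v \in R' -> v x \in values R' by move=> vR; apply/valuesP => //; exists v.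
have sub : values R' \subset C by apply: values_restrict.
have mE' a b c : a \in values R' -> b \in values R' -> c \in values R' ->
    m a b c = if b == c then b else a.
  by move=> aC bC cC; apply: mE; apply: (subsetP sub).
have [C1|C_gt1] := leqP #|values R'| 1.
  exists u; first exact: (subsetP R'R).
  by move=> x y; apply: (card_le1_eqP C1); apply: uv.
have [[v vR' vc]|[dich free]] := dual_disc_dichotomy shR' (erefl _) C_gt1 clm mE'.
  by exists v => //; apply: (subsetP R'R).
apply: (sections_family R'R (C := values R')) => //; first exact: ltnW.
exact: disjoint_sections dich free.
Qed.

Lemma full_constant : values R = setT ->
    (forall P, subalgebra_rel s setT P -> (forall a b, P a b) \/ exists B, splits P B) ->
    (forall P B, (forall k, 0 < k <= #|A| -> closed_rel k sy P) ->
       subalgebra_rel s setT P -> splits P B -> injective_rel P) ->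
  has_constant R.
Proof.
move=> valR rect simple.
pose Ops k p := 0 < k <= #|A| /\ p = sy \/ k = #|A|.+1 /\ p = twist s sy.
have A_gt0 : 0 < #|A| <= #|A| by rewrite leqnn ltnW.
apply: (sections_family (subxx R) (C := setT)) => //; first by rewrite cardsT ltnW.
apply: (rectangular_sections (Ops := Ops) (s := s) (q := sy)); rewrite ?cardsT //.
- move=> k p a [] [kA ->] _; first exact: (proj1 sySym).
  by rewrite kA /twist /= (proj1 sySym) // family2_idem.
- move=> P stP PC sl sr.
  have cl2 a b a' b' : P a b -> P a' b' -> P (s a a') (s b b').
    move=> Pab Pab'; apply: (stP 2 sy _ [:: (a, b); (a', b')]) => //; first by left.
    by rewrite /= Pab Pab'.
  have subP : subalgebra_rel s setT P by split.
  have [fl|[B spl]] := rect P subP; first by left=> a b _ _; apply: fl.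
  by right; apply: simple subP spl => k kA; apply: stP; left.
- by right.
- by move=> a _; apply: (proj1 sySym).
- by move=> l l' sz; apply: (proj2 sySym); rewrite sz.
- by move=> a b _ _; apply: family2C.
- by move=> a _; apply: family2_idem.
move=> k p [] [kA ->] us sz usR; first exact: (stR kA).
case: us sz usR => [|u us]; rewrite kA // => -[sz] usR.
rewrite (_ : lift _ _ = lift2 s (lift sy us) u); last by apply/ffunP=> x; rewrite !ffunE.
apply: family2_closed; last by apply: usR; rewrite inE eqxx.
by apply: (stR A_gt0) => // v vus; apply: usR; rewrite inE vus orbT.
Qed.

Lemma classified_constant : classified s -> values R = setT ->
    (forall P B, (forall k, 0 < k <= #|A| -> closed_rel k sy P) ->
       subalgebra_rel s setT P -> splits P B -> injective_rel P) ->
  has_constant R.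
Proof.
move=> cl valR simple; case: cl => [D a stD sta|C m stC C3 mm mE|C stC C3 sC rect|rect].
- have RT : restrict R setT != set0.
    have /imsetP[u uR _] : (sy [::]) \in values R by rewrite valR inE.
    by apply/set0Pn; exists u; apply/restrictP; split=> // x; rewrite inE.
  have stR' := step_restrict family2_closed shR valR.
  have /set0Pn[u /restrictP[uR ua]] := stR' _ _ sta (stR' _ _ stD RT).
  by exists u => // x y; rewrite !(set1P (ua _)).
- exact: disc_constant stC C3 valR mm mE.
- exact: ideal_constant stC C3 valR sC rect.
exact: full_constant.
Qed.

End Core.

End Relations.

(** The carriers ['I_n] index the induction on the size of the algebra. *)
Definition constants_at (gT : finGroupType) (n : nat) :=
  forall (sy : seq 'I_n -> 'I_n) (R : {set {ffun gT -> 'I_n}}),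
  symmetric_family sy -> shift_closed R -> R != set0 ->
  (forall k, 0 < k <= n -> closed_op k sy R) -> has_constant R.

(** * Quotients of subalgebras *)

Section Factor.

Variables (gT : finGroupType) (A : finType) (sy : seq A -> A) (R : {set {ffun gT -> A}}).
Variables (B : {set A}) (E : rel A).
Hypotheses (sySym : symmetric_family sy) (shR : shift_closed R).
Hypothesis stR : forall k, 0 < k <= #|A| -> closed_op k sy R.
Hypothesis congE : congruence sy E.
Hypothesis clB : forall l, 0 < size l <= #|A| -> all (mem B) l -> sy l \in B.

(** The quotient of [B] by [E], carried by representatives, has fewer elements than [A]: either [B]
    is proper or [E] identifies two of its elements. A constant of the quotient lifts to a member of
    [R] with all entries in one class. *)
Lemma factor_constant : (forall m, m < #|A| -> constants_at gT m) ->
    restrict R B != set0 ->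
    B != setT \/ (exists a b, [/\ a \in B, b \in B, a != b & E a b]) ->
  exists2 u, u \in R & (forall x, u x \in B) /\ (forall x y, E (u x) (u y)).
Proof.
move=> IH RB0 small; have [/equivalence_relP[rfl ltr] clE] := congE.
pose rep a := odflt a [pick b in B | E a b].
have repP a : a \in B -> rep a \in B /\ E a (rep a).
  by rewrite /rep => aB; case: pickP => [b /andP[]//|/(_ a)]; rewrite aB rfl.
have repE a b : a \in B -> E a b -> rep a = rep b.
  move=> aB Eab; rewrite /rep.
  have -> : [pick c in B | E b c] = [pick c in B | E a c].
    by apply: eq_pick => c; rewrite (ltr _ _ Eab).
  by case: pickP => // /(_ a); rewrite aB rfl.
pose I := [set rep a | a in B].
have IB : I \subset B by apply/subsetP=> _ /imsetP[a aB ->]; case: (repP a aB).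
have ltI : #|I| < #|A|.
  case: small => [BT|[a [b [aB bB ab Eab]]]].
    apply: leq_ltn_trans (subset_leq_card IB) _; rewrite -cardsT; apply: proper_card.
    by rewrite properT.
  apply: leq_trans (max_card B); rewrite ltn_neqAle leq_imset_card andbT.
  by apply: contraNN ab => /imset_injP inj; apply/eqP/inj => //; apply: repE.
have [u0 /restrictP[u0R u0B]] := set0Pn _ RB0.
have aI : rep (u0 1%g) \in I by apply: imset_f.
pose to a := enum_rank_in aI (rep a).
pose from (i : 'I_#|I|) := enum_val i.
have fromB i : from i \in B by apply: (subsetP IB); apply: enum_valP.
have fromto a : a \in B -> from (to a) = rep a.
  by move=> aB; rewrite /from enum_rankK_in //; apply: imset_f.
have Efromto a : a \in B -> E (from (to a)) a.
  by move=> aB; rewrite fromto // -(ltr _ _ (proj2 (repP a aB))).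
have toE a b : a \in B -> E a b -> to a = to b by move=> aB /(repE _ _ aB) H; rewrite /to H.
have repfrom i : rep (from i) = from i.
  have /imsetP[a aB eqi] : from i \in I by apply: enum_valP.
  by rewrite [in RHS]eqi eqi; have [rB Er] := repP a aB; rewrite -(repE a (rep a)).
have tofrom i : to (from i) = i by rewrite /to repfrom /from enum_valK_in.
pose sy' l := to (sy [seq from i | i <- l]).
have le_I k : 0 < k <= #|I| -> 0 < k <= #|A|.
  by case/andP=> -> /leq_trans-> //; apply: ltnW.
have fromall l : all (mem B) [seq from i | i <- l].
  by rewrite all_map; apply/allP=> i _ /=.
have symI : symmetric_family sy'.
  split=> [k i|l l']; rewrite card_ord => /le_I kA.
    by rewrite /sy' map_nseq (proj1 sySym).
  by move=> perm; rewrite /sy' (proj2 sySym _ [seq from i | i <- l']) ?size_map ?perm_map.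
pose R' := [set [ffun x => to (u x)] | u : {ffun gT -> A} in restrict R B].
have [v /imsetP[u /restrictP[uR uB] ->] cst] : has_constant R'.
  apply: (IH _ ltI sy' R' symI).
  - move=> _ g /imsetP[u uRB ->]; apply/imsetP; exists (shift u g); first exact: restrict_shift.
    by apply/ffunP=> x; rewrite !ffunE.
  - by apply/set0Pn; exists [ffun x => to (u0 x)]; apply/imset_f/restrictP.
  - move=> k kI us sz usR'.
    have [vs [szv vsR eqv]] : exists vs : seq {ffun gT -> A}, [/\ size vs = size us,
        {subset vs <= restrict R B} & forall x, [seq u x | u : {ffun gT -> 'I_#|I|} <- us]
          = [seq to (u x) | u : {ffun gT -> A} <- vs]].
      elim: us usR' {sz} => [|w us IHu] usR'; first by exists [::].
      have [|vs [szv vsR eqv]] := IHu; first by move=> w' w'us; apply: usR'; rewrite inE w'us orbT.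
      have /imsetP[v vR wv] : w \in R' by apply: usR'; rewrite inE eqxx.
      exists (v :: vs); split=> /=; first by rewrite szv.
        by move=> v'; rewrite inE => /predU1P[->|/vsR].
      by move=> x; rewrite eqv wv ffunE.
    have kA := le_I _ kI; rewrite -sz -szv in kA.
    have vsB x : all (mem B) [seq u x | u : {ffun gT -> A} <- vs].
      by rewrite all_map; apply/allP=> v /vsR /restrictP[_ vB] /=.
    apply/imsetP; exists (lift sy vs).
      apply/restrictP; split; first by apply: stR kA _ _ _ => // v /vsR/restrictP[].
      by move=> x; rewrite ffunE; apply: clB; rewrite ?size_map.
    apply/ffunP=> x; rewrite !ffunE eqv /sy'; apply: toE.
      by apply: clB; rewrite ?size_map.
    have := clE _ kA [seq (from (to (v x)), v x) | v : {ffun gT -> A} <- vs].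
    rewrite size_map /unzip1 /unzip2 -!map_comp all_map; apply=> //.
    by apply/allP=> v /vsR/restrictP[_ vB] /=; apply: Efromto.
exists u => //; split=> // x y; have := cst x y; rewrite !ffunE => eqto.
rewrite (ltr _ _ (proj2 (repP _ (uB x)))) -fromto // eqto fromto //.
by rewrite -(ltr _ _ (proj2 (repP _ (uB y)))).
Qed.

End Factor.

(** If the values form a proper subalgebra, induction applies to it. Otherwise the classification
    applies unless there is a proper nontrivial congruence; then the quotient gives a member inside
    one class, which is a proper subalgebra by idempotence. *)
Lemma constants_of_classified (gT : finGroupType) (N : nat) :
    (forall n (s : 'I_n -> 'I_n -> 'I_n), 1 < n <= N ->
       (forall x, s x x = x) -> commutative s -> classified s) ->
  forall n, n <= N -> constants_at gT n.
Proof.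
move=> cls n; elim/ltn_ind: n => n IHn nN sy R sySym shR R0 stR.
have [u0 u0R] := set0Pn _ R0.
have [n_le1|n_gt1] := leqP n 1.
  exists u0 => // x y; apply: ord_inj; move: (ltn_ord (u0 x)) (ltn_ord (u0 y)).
  by case: n n_le1 {IHn nN sy R sySym shR R0 stR u0R} u0 =>
    [|[|]] // _ u0; case: (u0 x) (u0 y) => [[]] // ? [[]].
have stR' k : 0 < k <= #|'I_n| -> closed_op k sy R by rewrite card_ord; apply: stR.
have IH m : m < #|'I_n| -> constants_at gT m.
  by rewrite card_ord => mn; apply: IHn => //; apply: leq_trans (ltnW mn) nN.
have eqcong : congruence sy eq_op.
  split; first by apply/equivalence_relP; split=> // a b /eqP ->.
  move=> k _ l _ eql; apply/eqP; congr sy; apply/eq_in_map => q ql.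
  by apply/eqP; move/allP: eql; apply.
have sub (B : {set 'I_n}) : (forall l, 0 < size l <= #|'I_n| -> all (mem B) l -> sy l \in B) ->
    B != setT -> restrict R B != set0 -> has_constant R.
  move=> clB BT RB; have [|u uR [_ cst]] := factor_constant sySym shR stR' eqcong clB IH RB.
    by left.
  by exists u => // x y; apply/eqP.
have [valT|valT] := eqVneq (values R) setT; last first.
  apply: (sub (values R)) => //.
    move=> l sz /allP lR; suff [us [szu usR eql]] : exists us : seq {ffun gT -> 'I_n},
        [/\ size us = size l, {subset us <= R} & l = [seq u 1%g | u : {ffun gT -> 'I_n} <- us]].
      apply/imsetP; exists (lift sy us); last by rewrite ffunE -eql.
      by apply: (stR' (size l)).
    elim: l lR {sz} => [|a l IHl] lR; first by exists [::].
    have [|us [szu usR eql]] := IHl; first by move=> b bl; apply: lR; rewrite inE bl orbT.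
    have /imsetP[u uR ua] : a \in values R by apply: lR; rewrite inE eqxx.
    exists (u :: us); rewrite /= szu -eql -ua; split=> // v.
    by rewrite inE => /predU1P[->|/usR].
  apply/set0Pn; exists u0; apply/restrictP; split=> // x.
  by apply/valuesP => //; exists u0.
(* With constants excluded, the congruence case below ends in a contradiction although its goal is
   [injective_rel]. *)
have [/exists_inP[u uR /forallP cst]|nocst] :=
    boolP [exists u in R, [forall x, forall y, u x == u y]].
  by exists u => // x y; apply/eqP/(forallP (cst x)).
have n_gt1' : 1 < #|'I_n| by rewrite card_ord.
apply: (classified_constant sySym n_gt1' shR stR' _ valT).
  apply: cls; rewrite ?n_gt1 //.
    exact: (family2_idem sySym).
  exact: (family2C sySym).
move=> P B clP [_ _ sl sr] spl.
have sl' a : exists b, P a b by apply: sl; rewrite inE.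
have sr' b : exists a, P a b by apply: sr; rewrite inE.
have [unl|[E [congE nontriv [a [b Eab]]]]] := split_congruence clP sl' sr' spl.
  exact: injective_of_unlinked.
case/negP: nocst; suff [u uR cst] : has_constant R.
  by apply/exists_inP; exists u => //; apply/forallP=> x; apply/forallP=> y; rewrite (cst x y).
have RT : restrict R setT != set0.
  by apply/set0Pn; exists u0; apply/restrictP; split=> // x; rewrite inE.
have [||u uR [_ Eu]] := factor_constant sySym shR stR' congE _ IH RT.
- by move=> l _ _; rewrite inE.
- by right; have [c [d [cd Ecd]]] := nontriv; exists c, d; rewrite !inE.
have [/equivalence_relP[rfl ltr] clE] := congE.
apply: (sub [set c | E (u 1%g) c]).
- move=> l sz lB; rewrite inE.
  pose L := [seq (u 1%g, c) | c <- l].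
  have L1 : unzip1 L = nseq (size l) (u 1%g) by rewrite /L; elim: (l) => //= c l' ->.
  have L2 : unzip2 L = l by rewrite /L; elim: (l) => //= c l' ->.
  have := clE _ sz L; rewrite L1 L2 size_map all_map (proj1 sySym) //; apply=> //.
  by apply/allP=> c cl /=; have := allP lB c cl; rewrite /= inE.
- apply: contraNneq Eab => ET.
  have Ec c : E (u 1%g) c by have := in_setT c; rewrite -ET inE.
  by rewrite -(ltr _ _ (Ec a)).
by apply/set0Pn; exists u; apply/restrictP; split=> // x; rewrite inE.
Qed.

(** * Commutative idempotent tables on at most four elements *)

Definition table := seq (seq nat).
Definition look (M : table) (i j : nat) : nat := nth 0 (nth [::] M i) j.
Definition tabulate n (t : nat -> nat -> nat) : table :=
  mkseq (fun i => mkseq (t i) n) n.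

(* [vm_compute] evaluates both arguments of [&&], [||], [==>]; these short-circuit. *)
Local Notation "a <&> b" := (if a then b else false) (at level 40, left associativity).
Local Notation "a <|> b" := (if a then true else b) (at level 50, left associativity).
Local Notation "a =>> b" := (if a then b else true) (at level 55, right associativity).
Fixpoint some (T : Type) (p : pred T) (l : seq T) :=
  if l is x :: l' then p x <|> some p l' else false.

Definition word := seq bool.
Definition bit (C : word) (k : nat) := nth false C k.
Fixpoint words (T : Type) (l : seq T) k : seq (seq T) :=
  if k is k'.+1 then [seq b :: m | b <- l, m <- words l k'] else [:: [::]].

Section Check.
Variable n : nat.

Definition below (p : pred nat) := all p (iota 0 n).

Definition keepsb (t : nat -> nat -> nat) (C : word) :=
  below (fun y => bit C y =>> below (fun x => bit C (t x y))).

Definition grow (ts : seq table) (Q : word) : word :=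
  mkseq (fun a => bit Q a <|> some (fun t => some (fun x => bit Q (look t x a)) (iota 0 n)) ts) n.

(** A round of [grow] that changes nothing is final, so [n] rounds compute the whole backward
    closure of [C]. *)
Definition stepb (ts : seq table) (D C : word) :=
  let valid := [seq t <- ts | keepsb (look t) C <&> keepsb (look t) D] in
  let Q := iter n (grow valid) C in
  below (fun a => bit D a =>> bit Q a).

Definition discb (m : nat -> nat -> nat -> nat) (C : word) :=
  below (fun x => bit C x =>> below (fun y => bit C y =>> below (fun z => bit C z =>>
     (m x y z == if y == z then y else x)))).

Definition embedb (s : nat -> nat -> nat) k (r : nat -> nat -> nat) (phi : seq nat) :=
  (size phi == k) <&> uniq phi <&> all (fun c => c < n) phi <&>
  all (fun j => all (fun i => s (nth 0 phi i) (nth 0 phi j) == nth 0 phi (r i j)) (iota 0 k)) (iota 0 k).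
Definition idealb (s : nat -> nat -> nat) (phi : seq nat) :=
  below (fun x => all (fun c => s x c \in phi) phi).
Definition full_word : word := nseq n true.
Definition single a : word := mkseq (fun i => i == a) n.
Definition word_of (phi : seq nat) : word := mkseq (fun i => i \in phi) n.
End Check.

(* A table is encoded by its entries at (0,1), (0,2), (1,2), (0,3), (1,3), (2,3). *)
Definition from_vec (v : seq nat) (i j : nat) : nat :=
  if i == j then i else nth 0 v ('C(maxn i j, 2) + minn i j).
(* Up to isomorphism, the four-element tables not settled by the other tests of
   [classifyb]. *)
Definition reps4 : seq table := [seq tabulate 4 (from_vec v) | v <- [::
 [:: 0; 0; 0; 3; 1; 2];
 [:: 0; 0; 0; 3; 2; 1];
 [:: 0; 0; 1; 3; 0; 2];
 [:: 0; 0; 1; 3; 1; 2];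
 [:: 0; 0; 1; 3; 2; 1];
 [:: 0; 0; 1; 3; 2; 2];
 [:: 0; 0; 3; 3; 1; 2];
 [:: 0; 0; 3; 3; 2; 1];
 [:: 0; 1; 0; 3; 0; 2];
 [:: 0; 1; 0; 3; 1; 2];
 [:: 0; 1; 0; 3; 2; 1];
 [:: 0; 1; 0; 3; 2; 2];
 [:: 0; 1; 1; 3; 0; 2];
 [:: 0; 1; 3; 3; 2; 1];
 [:: 0; 2; 3; 2; 0; 1];
 [:: 0; 2; 3; 2; 2; 1];
 [:: 0; 2; 3; 3; 2; 1];
 [:: 0; 3; 0; 2; 0; 1];
 [:: 0; 3; 0; 2; 2; 1];
 [:: 0; 3; 3; 2; 2; 1];
 [:: 2; 1; 3; 1; 0; 0];
 [:: 2; 1; 3; 1; 0; 1];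
 [:: 0; 1; 3; 2; 0; 2]]].
(** Rock-paper-scissors, and the operation [2(x + y)] modulo 3. *)
Definition reps3 : seq table :=
  [seq tabulate 3 (from_vec v) | v <- [:: [:: 0; 2; 1]; [:: 2; 1; 0]]].
Definition arrangements k n := [seq phi <- words (iota 0 n) k | uniq phi].

Definition to_vec n (t : nat -> nat -> nat) :=
  flatten [seq [seq t i j | i <- iota 0 j] | j <- iota 0 n].
(* Nothing is proved about this list: [classifyb] checks the embedding it finds. *)
Definition relabelings : seq (seq nat * (table * seq nat)) :=
  [seq (to_vec 4 (fun i j => index (look M (nth 0 phi i) (nth 0 phi j)) phi),
        (M, mkseq (fun i => index i phi) 4)) | M <- reps4, phi <- arrangements 4 4].

Section Classify.
Variables (n : nat) (cands : seq (seq nat * (table * seq nat)))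
  (arr : seq (seq nat)) (sets : seq word).

(** [ClassifiedConst] is tried twice: in one stage at the start, and with a halfway set at the end.
    The parameters let the auxiliary lists be computed once for all tables. *)
Definition classifyb (v : seq nat) : bool :=
  let M := tabulate n (from_vec v) in
  let s := look M in
  let T2 := tabulate n (rmul2 s) in
  let T3 := tabulate n (rmul3 s) in
  let st := stepb n [:: T2; T3] in
  some (fun a => st (full_word n) (single n a)) (iota 0 n) <|>
      some (fun C => (count (bit C) (iota 0 n) <= 3) <&> st (full_word n) C <&>
              (discb n (maj1 s) C <|> discb n (maj2 s) C)) sets <|>
      some (fun r => some (fun phi => embedb n s 3 (look r) phi <&> idealb n s phi <&>
              st (full_word n) (word_of n phi)) arr) reps3 <|>
      (n == 4) <&> some (fun c => (c.1 == v) <&> embedb n s 4 (look c.2.1) c.2.2) cands <|>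
      some (fun D => st (full_word n) D <&> some (fun a => st D (single n a)) (iota 0 n)) sets.
End Classify.

Definition classify_all n :=
  all (classifyb n relabelings (arrangements 3 n) (words [:: true; false] n))
    (words (iota 0 n) 'C(n, 2)).

(** * Enumeration of subdirect relations *)

Section Rows.
Variables (n : nat) (s : nat -> nat -> nat).

Definition productb (U V W : word) :=
  below n (fun a => bit U a =>> below n (fun b => bit V b =>> bit W (s a b))).

(* Only the products that involve the last row are tested. *)
Definition row_ok (r : seq word) :=
  let k := (size r).-1 in
  all (fun i => all (fun j => let m := s i j in
    ((m <= k) <&> ((j == k) <|> (m == k))) =>>
      productb (nth [::] r i) (nth [::] r j) (nth [::] r m)) (iota i (k.+1 - i)))
   (iota 0 k.+1).

(** By idempotence each row of a subdirect relation is a nonempty subalgebra, so only these are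
    appended; incompatible prefixes are discarded early. *)
Definition rows (k : nat) : seq (seq word) :=
  let W := [seq U <- words [:: true; false] n | has id U <&> productb U U U] in
  iter k (fun L => [seq r <- [seq rcons r U | r <- L, U <- W] | row_ok r]) [:: [::]].

Definition rel_of (r : seq word) a b := bit (nth [::] r a) b.
Definition ontob (r : seq word) := below n (fun b => some (fun a => rel_of r a b) (iota 0 n)).
Definition fullb (r : seq word) := below n (fun a => below n (fun b => rel_of r a b)).
Definition injb (r : seq word) := below n (fun a => below n (fun b => rel_of r a b =>>
   below n (fun a' => below n (fun b' => rel_of r a' b' =>> ((a == a') == (b == b')))))).
Definition separates (r : seq word) (B : word) :=
  some (bit B) (iota 0 n) <&> some (fun a => ~~ bit B a) (iota 0 n) <&>
  below n (fun b => below n (fun a => rel_of r a b =>>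
    below n (fun a' => rel_of r a' b =>> (bit B a == bit B a')))).
Definition splitb (r : seq word) := some (separates r) (words [:: true; false] n).

Definition rectangularb (Q : seq word -> bool) :=
  below n (fun a => below n (fun b => s a b < n)) <&>
  all (fun r => ontob r =>> (fullb r <|> Q r)) (rows n).
End Rows.

(** There are 2, 27 and 4096 tables. *)
Lemma classify_allT : all classify_all [:: 2; 3; 4].
Proof. by vm_cast_no_check (erefl true). Qed.

Lemma reps4_rectangular : all (fun M => rectangularb 4 (look M) (splitb 4)) reps4.
Proof. by vm_cast_no_check (erefl true). Qed.

Lemma reps3_rectangular : all (fun M => rectangularb 3 (look M) (injb 3)) reps3.
Proof. by vm_cast_no_check (erefl true). Qed.

Lemma if_andb (a b : bool) : (a <&> b) = a && b. Proof. by case: a. Qed.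
Lemma if_orb (a b : bool) : (a <|> b) = a || b. Proof. by case: a. Qed.
Lemma if_implyb (a b : bool) : (a =>> b) = (a ==> b). Proof. by case: a. Qed.
Lemma someE T (p : pred T) l : some p l = has p l.
Proof. by elim: l => //= x l ->. Qed.

Lemma belowP n (p : pred nat) : reflect (forall i, i < n -> p i) (below n p).
Proof.
apply: (iffP allP) => H i; first by move=> lin; apply: H; rewrite mem_iota.
by rewrite mem_iota => /andP[_]; apply: H.
Qed.

Lemma has_iotaP n (p : pred nat) : reflect (exists2 i, i < n & p i) (has p (iota 0 n)).
Proof.
apply: (iffP hasP) => -[i lin pi]; exists i => //; last by rewrite mem_iota.
by rewrite mem_iota in lin.
Qed.

Lemma look_tabulate n t i j : i < n -> j < n -> look (tabulate n t) i j = t i j.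
Proof. by move=> lin ljn; rewrite /look !nth_mkseq. Qed.

Lemma mem_words (T : eqType) (l m : seq T) k :
  (m \in words l k) = (size m == k) && all (fun x => x \in l) m.
Proof.
elim: k m => [|k IH] [|x m] //=; first by apply/allpairsP => -[[y m'] [_ _]].
rewrite eqSS andbCA -IH; apply/allpairsP/andP => [[[y m'] /= [yl ml [-> ->]]]|[xl ml]] //.
by exists (x, m).
Qed.

(** * Soundness of the table checks *)

Section Sound.

Variables (n : nat) (s : 'I_n -> 'I_n -> 'I_n) (M : table).
Hypothesis lookM : forall i j : 'I_n, look M i j = s i j.

Definition set_of (C : word) : {set 'I_n} := [set i : 'I_n | bit C i].

Lemma keepsP (t : nat -> nat -> nat) (u : 'I_n -> 'I_n -> 'I_n) C : (forall i j : 'I_n, t i j = u i j) ->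
  keepsb n t C -> keeps u (set_of C).
Proof.
move=> tu /belowP kC x y; rewrite !inE => yC; have := kC y (ltn_ord y).
by rewrite yC => /belowP/(_ x (ltn_ord x)); rewrite tu.
Qed.

Let T2 := tabulate n (rmul2 (look M)).
Let T3 := tabulate n (rmul3 (look M)).

Lemma look_rmul2 (i j : 'I_n) : look T2 i j = rmul2 s i j.
Proof. by rewrite look_tabulate // /rmul2 !lookM. Qed.

Lemma look_rmul3 (i j : 'I_n) : look T3 i j = rmul3 s i j.
Proof. by rewrite look_tabulate // /rmul3 /rmul2 !lookM. Qed.

Lemma stepP D C : stepb n [:: T2; T3] D C -> step s (set_of D) (set_of C).
Proof.
move=> /belowP stDC a; rewrite inE => aD; have := stDC a (ltn_ord a); rewrite aD {aD stDC}.
set valid := filter _ _; move: {1}n => k; elim: k a => [|k IH] a /=.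
  by move=> aC; apply: Reach0; rewrite inE.
rewrite /bit nth_mkseq // -/(bit _ _) if_orb => /orP[|]; first exact: IH.
rewrite someE => /hasP[t]; rewrite mem_filter if_andb => /andP[/andP[kC kD] t23].
rewrite someE => /has_iotaP[x ltx]; pose x' := Ordinal ltx.
have [u [u23 tu]] : exists u : 'I_n -> 'I_n -> 'I_n,
    (u = rmul2 s \/ u = rmul3 s) /\ forall i j : 'I_n, look t i j = u i j.
  move: t23; rewrite !inE => /orP[] /eqP ->.
    by exists (rmul2 s); split; [left | exact: look_rmul2].
  by exists (rmul3 s); split; [right | exact: look_rmul3].
rewrite (tu x' a) => /IH; apply: ReachS => //; exact: keepsP tu _.
Qed.

Lemma set_of_full : set_of (full_word n) = setT.
Proof. by apply/setP=> i; rewrite !inE /bit nth_nseq ltn_ord. Qed.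

Lemma set_of_single (a : 'I_n) : set_of (single n a) = [set a].
Proof. by apply/setP=> i; rewrite !inE /bit nth_mkseq. Qed.

Lemma card_set_of C : #|set_of C| = count (bit C) (iota 0 n).
Proof. by rewrite -val_enum_ord count_map cardsE cardE size_filter enumT. Qed.

(** [m] is polymorphic in the carrier so that one term is read both in the numeric table and in
    ['I_n]. *)
Lemma discP (m : forall T, (T -> T -> T) -> T -> T -> T -> T) C :
    (forall i j k : 'I_n, m _ (look M) i j k = m _ s i j k) -> discb n (m _ (look M)) C ->
  forall a b c, a \in set_of C -> b \in set_of C -> c \in set_of C ->
  m _ s a b c = if b == c then b else a.
Proof.
move=> mM /belowP d a b c; rewrite !inE => aC bC cC.
have := d a (ltn_ord a); rewrite aC => /belowP/(_ b (ltn_ord b)).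
rewrite bC => /belowP/(_ c (ltn_ord c)); rewrite cC mM => /eqP mabc.
by apply: val_inj; rewrite /= mabc -val_eqE /=; case: ifP.
Qed.

End Sound.

Section RowsSound.

Variables (n : nat) (t : nat -> nat -> nat) (P : rel nat).
Hypothesis tn : forall a b, a < n -> b < n -> t a b < n.
Hypothesis tP : forall a b a' b', a < n -> b < n -> a' < n -> b' < n ->
  P a b -> P a' b' -> P (t a a') (t b b').
Hypothesis leftP : forall a, a < n -> exists2 b, b < n & P a b.

Definition row a : word := mkseq (P a) n.

Lemma bit_row a b : b < n -> bit (row a) b = P a b.
Proof. by move=> ltb; rewrite /bit nth_mkseq. Qed.

Lemma product_row a a' : a < n -> a' < n -> productb n t (row a) (row a') (row (t a a')).
Proof.
move=> lta lta'; apply/belowP=> b ltb; rewrite if_implyb bit_row //; apply/implyP=> Pab.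
apply/belowP=> b' ltb'; rewrite if_implyb !bit_row ?tn //; apply/implyP; exact: tP.
Qed.

Hypothesis t_idem : forall a, a < n -> t a a = a.

(** Completeness of the enumeration: no prefix of a subdirect relation is filtered out. *)
Lemma mem_rows k : k <= n -> mkseq row k \in rows n t k.
Proof.
elim: k => [|k IH] ltk //=; rewrite mem_filter; apply/andP; split.
  apply/allP=> i; rewrite size_mkseq mem_iota => /andP[_ lti] /=.
  apply/allP=> j; rewrite mem_iota => /andP[_ ltj]; rewrite if_implyb.
  have {ltj} ltj : j < k.+1 by rewrite subnKC // ltnW // in ltj.
  apply/implyP; rewrite if_andb => /andP[lem _].
  by rewrite !nth_mkseq //; apply: product_row; apply: leq_trans ltk.
rewrite -[mkseq row k.+1]/(map row (iota 0 k.+1)) -addn1 iotaD map_cat cats1.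
apply: allpairs_f; first exact: IH (ltnW ltk).
rewrite mem_filter if_andb -{4}(t_idem ltk) product_row // andbT mem_words size_mkseq eqxx /=.
apply/andP; split; last by apply/allP=> -[].
have [b ltb Pkb] := leftP ltk; apply/hasP; exists true => //.
by apply/mapP; exists b; rewrite ?mem_iota.
Qed.

Lemma rel_row a b : a < n -> b < n -> rel_of (mkseq row n) a b = P a b.
Proof. by move=> lta ltb; rewrite /rel_of nth_mkseq // bit_row. Qed.

Lemma rectangular_row Q : rectangularb n t Q ->
    (forall b, b < n -> exists2 a, a < n & P a b) ->
  (forall a b, a < n -> b < n -> P a b) \/ Q (mkseq row n).
Proof.
rewrite /rectangularb if_andb => /andP[_ /allP/(_ _ (mem_rows (leqnn n)))].
rewrite if_implyb if_orb => /implyP H sr; have /H/orP[] : ontob n (mkseq row n).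
- apply/belowP=> b /[dup] ltb /sr[a lta Pab]; rewrite someE; apply/has_iotaP.
  by exists a; rewrite ?rel_row.
- move=> /belowP fl; left=> a b lta ltb; move/belowP: (fl a lta) => /(_ b ltb).
  by rewrite rel_row.
by right.
Qed.

Lemma inj_row : injb n (mkseq row n) -> forall a b a' b', a < n -> b < n -> a' < n -> b' < n ->
  P a b -> P a' b' -> (a == a') = (b == b').
Proof.
move=> /belowP ij a b a' b' la lb la' lb' Pab Pab'.
move/belowP: (ij a la) => /(_ b lb); rewrite rel_row // Pab.
by move=> /belowP/(_ a' la')/belowP/(_ b' lb'); rewrite rel_row // Pab' => /eqP.
Qed.

Lemma split_row : splitb n (mkseq row n) -> exists B : word,
  [/\ exists2 a, a < n & bit B a, exists2 a, a < n & ~~ bit B a &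
   forall a a' b, a < n -> a' < n -> b < n -> P a b -> P a' b -> bit B a = bit B a'].
Proof.
rewrite /splitb someE => /hasP[B _]; rewrite /separates !if_andb !someE.
move=> /andP[/andP[/has_iotaP B1 /has_iotaP B2] /belowP B3]; exists B; split=> //.
move=> a a' b la la' lb Pab Pa'b; move/belowP: (B3 b lb) => /(_ a la).
by rewrite rel_row // Pab => /belowP/(_ a' la'); rewrite rel_row // Pa'b => /eqP.
Qed.

End RowsSound.

(** * Transport along an embedding of tables *)

Section Embedding.

Variables (n k : nat) (s : 'I_n.+1 -> 'I_n.+1 -> 'I_n.+1) (M : table) (r : nat -> nat -> nat).
Variable phi : seq nat.
Hypothesis lookM : forall i j : 'I_n.+1, look M i j = s i j.
Hypothesis s_idem : forall x, s x x = x.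
Hypothesis emb : embedb n.+1 (look M) k r phi.
Hypothesis rk : below k (fun a => below k (fun b => r a b < k)).

Let f i : 'I_n.+1 := inord (nth 0 phi i).
Definition image_of : {set 'I_n.+1} := set_of n.+1 (word_of n.+1 phi).

Lemma embedP : [/\ size phi = k, uniq phi, all (fun c => c < n.+1) phi
  & forall i j, i < k -> j < k -> s (f i) (f j) = f (r i j)].
Proof.
move: emb; rewrite /embedb !if_andb => /andP[/andP[/andP[/eqP sz un] lt] /allP hom].
have fE i : i < k -> f i = nth 0 phi i :> nat.
  by move=> lik; apply: inordK; apply: (allP lt); rewrite mem_nth ?sz.
split=> // i j lik ljk; apply: val_inj; rewrite /= -lookM !fE //.
  have /hom/allP : j \in iota 0 k by rewrite mem_iota.
  by move=> /(_ i); rewrite mem_iota => /(_ lik)/eqP.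
by move/belowP: rk => /(_ i lik)/belowP; apply.
Qed.

Lemma embed_val i : i < k -> f i = nth 0 phi i :> nat.
Proof.
move=> lik; have [sz _ lt _] := embedP.
by apply: inordK; apply: (allP lt); rewrite mem_nth ?sz.
Qed.

Lemma embed_inj i j : i < k -> j < k -> (f i == f j) = (i == j).
Proof.
move=> lik ljk; have [sz un _ _] := embedP.
by rewrite -val_eqE /= !embed_val // nth_uniq ?sz.
Qed.

Lemma image_ofP x : reflect (exists2 i, i < k & x = f i) (x \in image_of).
Proof.
have [sz _ _ _] := embedP; rewrite inE /bit nth_mkseq //.
apply: (iffP (nthP 0)) => -[i]; rewrite sz => lik xi; exists i => //.
  by apply: val_inj; rewrite /= embed_val.
by rewrite xi embed_val.
Qed.

Lemma card_image_of : #|image_of| = k.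
Proof.
have [sz un lt _] := embedP; rewrite -sz /image_of card_set_of.
rewrite -size_filter -(size_map id); apply/eqP; rewrite eqn_leq; apply/andP; split.
  apply: uniq_leq_size; first by rewrite map_id filter_uniq ?iota_uniq.
  move=> i; rewrite map_id mem_filter mem_iota => /andP[+ lin].
  by rewrite /bit nth_mkseq.
apply: uniq_leq_size => // c cphi; have ltc := allP lt c cphi.
by rewrite map_id mem_filter mem_iota /bit nth_mkseq // cphi.
Qed.

(** The relation is pulled back along [f] to indices below [k], where [r] inherits idempotence from
    [s] because [f] is injective. *)
Lemma rectangular_image Q (P : rel 'I_n.+1) : rectangularb k r Q ->
    subalgebra_rel s image_of P ->
  {in image_of &, forall a b, P a b} \/
  Q (mkseq (row k (fun i j => P (f i) (f j))) k).
Proof.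
move=> rect [clP PC sl sr]; have [_ _ _ hom] := embedP.
have rP i : i < k -> f i \in image_of by move=> lik; apply/image_ofP; exists i.
have rkk a b : a < k -> b < k -> r a b < k.
  by move=> la lb; move/belowP: rk => /(_ a la)/belowP; apply.
pose P' a b := P (f a) (f b).
have tP a b a' b' : a < k -> b < k -> a' < k -> b' < k ->
    P' a b -> P' a' b' -> P' (r a a') (r b b').
  by move=> la lb la' lb' Pab Pab'; rewrite /P' -!hom //; apply: clP.
have lP a : a < k -> exists2 b, b < k & P' a b.
  move=> /rP/sl[y Pay]; have [_ /image_ofP[b lb yb]] := PC _ _ Pay.
  by exists b; rewrite // /P' -yb.
have r_idem a : a < k -> r a a = a.
  by move=> la; apply/eqP; rewrite -embed_inj ?rkk // -hom // s_idem.
have srP b : b < k -> exists2 a, a < k & P' a b.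
  move=> /rP/sr[x Pxb]; have [/image_ofP[a la xa] _] := PC _ _ Pxb.
  by exists a; rewrite // /P' -xa.
have [fl|] := rectangular_row rkk tP lP r_idem rect srP; last by right.
by left=> _ _ /image_ofP[a la ->] /image_ofP[b lb ->]; apply: fl.
Qed.

Lemma injective_image (P : rel 'I_n.+1) : rectangularb k r (injb k) ->
    subalgebra_rel s image_of P ->
  {in image_of &, forall a b, P a b} \/ injective_rel P.
Proof.
move=> rect subP; have [|ij] := rectangular_image rect subP; [by left | right].
have [clP PC sl sr] := subP.
move=> a b a' b' Pab Pab'; have [/image_ofP[i li ai] /image_ofP[j lj bj]] := PC _ _ Pab.
have [/image_ofP[i' li' ai'] /image_ofP[j' lj' bj']] := PC _ _ Pab'.
move: Pab Pab'; rewrite ai bj ai' bj' => Pab Pab'.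
by rewrite !embed_inj //; apply: (inj_row ij).
Qed.

Lemma split_image (P : rel 'I_n.+1) : k = n.+1 -> rectangularb k r (splitb k) ->
    subalgebra_rel s setT P ->
  (forall a b, P a b) \/ exists B, splits P B.
Proof.
move=> kn rect subP.
have imT : image_of = setT by apply/eqP; rewrite eqEcard subsetT /= cardsT card_image_of kn card_ord leqnn.
have onto x : exists2 i, i < k & x = f i by apply/image_ofP; rewrite imT inE.
rewrite -imT in subP; have [fl|sp] := rectangular_image rect subP.
  by left=> a b; apply: fl; rewrite imT inE.
right; have [B [[i0 li0 Bi0] [i1 li1 Bi1] Bsep]] := split_row sp.
pose BI := [set x : 'I_n.+1 | [exists i : 'I_k, (f i == x) && bit B i]].
have BIE i : i < k -> (f i \in BI) = bit B i.
  move=> li; rewrite inE; apply/existsP/idP => [[j]|Bi]; last by exists (Ordinal li); rewrite eqxx.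
  by rewrite embed_inj // => /andP[/eqP <-].
exists BI; split.
- by apply/set0Pn; exists (f i0); rewrite BIE.
- by apply: contraNneq Bi1 => BT; rewrite -BIE // BT inE.
move=> a a' b; have [i li ->] := onto a; have [i' li' ->] := onto a'; have [j lj ->] := onto b.
by move=> Pij Pi'j; rewrite !BIE //; exact: (Bsep _ _ _ li li' lj Pij Pi'j).
Qed.

End Embedding.

Lemma classify_sound n (s : 'I_n -> 'I_n -> 'I_n) v :
  (forall i j : 'I_n, from_vec v i j = s i j) -> (forall x, s x x = x) -> 1 < n ->
  classifyb n relabelings (arrangements 3 n) (words [:: true; false] n) v -> classified s.
Proof.
case: n s => // n s vs s_idem n_gt0; rewrite /classifyb.
set M := tabulate n.+1 (from_vec v).
have lookM (i j : 'I_n.+1) : look M i j = s i j by rewrite look_tabulate ?vs.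
have stP D C := @stepP _ s M lookM D C.
rewrite !if_orb !if_andb !someE => /orP[/orP[/orP[/orP[|]|]|]|].
- move=> /has_iotaP[a lta /stP]; rewrite set_of_full (set_of_single (Ordinal lta)) => st.
  by apply: (ClassifiedConst (D := setT)) st => b; rewrite inE => _; apply: Reach0; rewrite inE.
- move=> /hasP[C _]; rewrite !if_andb if_orb => /andP[/andP[C3 /stP]].
  rewrite set_of_full => st; rewrite -(card_set_of n.+1 C) in C3.
  move=> /orP[] d; [apply: (ClassifiedDisc (m := maj1 s)) st C3 _ _ |
    apply: (ClassifiedDisc (m := maj2 s)) st C3 _ _].
  + by left.
  + by apply: discP d => i j k; rewrite /maj1 /rmul3 /rmul2 !lookM.
  + by right.
  by apply: discP d => i j k; rewrite /maj2 /rmul3 /rmul2 !lookM.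
- move=> /hasP[r r3]; rewrite someE => /hasP[phi _]; rewrite !if_andb => /andP[/andP[emb idl] /stP].
  rewrite set_of_full => st; have := allP reps3_rectangular r r3.
  move=> rect; have rk := rect; rewrite /rectangularb if_andb in rk; case/andP: rk => rk _.
  apply: ClassifiedIdeal st (card_image_of lookM emb rk) _ _.
    move=> x y yI; move/belowP: idl => /(_ x (ltn_ord x))/allP.
    have [sz un lt _] := embedP lookM emb rk.
    move: yI; rewrite !inE /bit !nth_mkseq // => yphi /(_ y yphi).
    by rewrite lookM.
  by move=> P; apply: (injective_image lookM s_idem emb rk rect).
- move=> /andP[/eqP n4] /hasP[c /allpairsP[[N phi0] /= [N4 _ ->]] /=].
  rewrite if_andb => /andP[_ emb]; have rect := allP reps4_rectangular N N4.
  have rk := rect; rewrite /rectangularb if_andb in rk; case/andP: rk => rk _.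
  by apply: ClassifiedFull => P; apply: (split_image lookM s_idem emb rk).
move=> /hasP[D _]; rewrite if_andb someE => /andP[/stP + /has_iotaP[a lta /stP]].
rewrite set_of_full (set_of_single (Ordinal lta)) => st st'.
exact: ClassifiedConst st st'.
Qed.

Lemma from_to_vec n (t : nat -> nat -> nat) i j : n <= 4 ->
    (forall a b, a < n -> b < n -> t a b = t b a) -> (forall a, a < n -> t a a = a) ->
    i < n -> j < n -> from_vec (to_vec n t) i j = t i j.
Proof.
move=> n4 tC tt; have lt (a b : nat) : a < b -> b < n -> from_vec (to_vec n t) a b = t a b.
  by case: n n4 {tC tt} => [|[|[|[|[]]]]] // _; case: b => [|[|[|[]]]] // ab _; case: a ab => [|[|[]]].
have symm a b : from_vec (to_vec n t) a b = from_vec (to_vec n t) b a.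
  by rewrite /from_vec maxnC minnC; case: eqVneq => [->|/negPf]; rewrite ?eqxx // eq_sym => ->.
move=> ltin ltjn; case: (ltngtP i j) => [ij|ji|->]; first exact: lt.
  by rewrite symm lt // tC.
by rewrite /from_vec eqxx tt.
Qed.

Lemma classified_le4 n (s : 'I_n -> 'I_n -> 'I_n) : 1 < n <= 4 ->
  (forall x, s x x = x) -> commutative s -> classified s.
Proof.
move=> n24 s_idem sC; case: n s n24 s_idem sC => // n s /andP[n_gt1 n_le4] s_idem sC.
pose t i j : nat := s (inord i) (inord j).
apply: (classify_sound (v := to_vec n.+1 t)) => //; last first.
  have : n.+1 \in [:: 2; 3; 4] by case: (n) n_gt1 n_le4 => [|[|[|[|]]]].
  move=> /(allP classify_allT)/allP; apply; rewrite mem_words; apply/andP; split.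
    by case: (n) n_gt1 n_le4 => [|[|[|[|]]]].
  by apply/allP=> x /flatten_mapP[j _ /mapP[i _ ->]]; rewrite mem_iota ltn_ord.
have tE (i j : 'I_n.+1) : t i j = s i j by rewrite /t !inord_val.
move=> i j; rewrite from_to_vec ?tE // => [a b _ _|a lta]; first by rewrite /t sC.
by rewrite /t s_idem inordK.
Qed.

(** * Clones *)

(** Membership in the clone becomes boolean, as finite sets and minimization over operations
    require. *)
Definition holds (P : Prop) : bool := if excluded_middle_informative P then true else false.

Lemma holdsP (P : Prop) : reflect P (holds P).
Proof. by rewrite /holds; case: excluded_middle_informative => H; constructor. Qed.

Section Clone.

Variables (D : finType) (O : forall k : nat, operation D k -> Prop).
Hypothesis O_clone : clone O.

Definition unary (c : operation D 1) a := c [ffun=> a].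

Lemma unary_eta (c : operation D 1) x : c x = unary c (x ord0).
Proof. by congr (c _); apply/ffunP=> i; rewrite ffunE ord1. Qed.

Lemma O_unary_comp c h : O c -> O h -> O (composition c (fun _ : 'I_1 => h) : operation D 1).
Proof. by move=> Oc Oh; apply: (clone_composition O_clone). Qed.

Definition diagonal k (p : operation D k) : operation D 1 :=
  composition p (fun _ => projection D (ord0 : 'I_1)).

Lemma O_diagonal k (p : operation D k) : O p -> O (diagonal p).
Proof.
by move=> Op; apply: (clone_composition O_clone) => // i; apply: (clone_projection O_clone).
Qed.

Lemma unary_comp c h a :
  unary (composition c (fun _ : 'I_1 => h)) a = unary c (unary h a).
Proof. by rewrite /unary ffunE; congr (c _); apply/ffunP=> i; rewrite !ffunE. Qed.

Lemma unary_diagonal k (p : operation D k) a : unary (diagonal p) a = p [ffun=> a].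
Proof. by rewrite /unary ffunE; congr (p _); apply/ffunP=> i; rewrite !ffunE. Qed.

(* [U] is the image of a unary operation of least rank: every unary operation,
   followed by [c], permutes [U], so that symmetric operations can be made
   idempotent on [U]. *)
Lemma idempotent_core : exists (U : {set D}) (c : operation D 1),
  [/\ O c, forall a, unary c a \in U & forall k (p : operation D k), O p -> symmetric_op p ->
    exists q : operation D k, [/\ O q, symmetric_op q, forall x, q x \in U &
      forall a, a \in U -> q [ffun=> a] = a]].
Proof.
pose img (c : operation D 1) := [set unary c a | a : D].
pose idop : operation D 1 := projection D ord0.
have Oid : idop \in [pred c : operation D 1 | holds (O c)].
  by apply/holdsP/(clone_projection O_clone).
case: (@arg_minnP _ idop _ (fun c => #|img c|) Oid) => c /holdsP Oc minc.
exists (img c), c; split=> // [a|k p Op symp]; first exact: imset_f.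
pose h := composition c (fun _ : 'I_1 => diagonal p).
have Oh : O h by apply: O_unary_comp => //; apply: O_diagonal.
have hU a : unary h a \in img c by rewrite unary_comp; apply: imset_f.
(* Otherwise [h] after [c] would have smaller rank than [c]. *)
have hI : {in img c &, injective (unary h)}.
  apply/imset_injP; rewrite eqn_leq leq_imset_card /=.
  have Ohc : holds (O (composition h (fun _ : 'I_1 => c))) by apply/holdsP/O_unary_comp.
  apply: leq_trans (minc _ Ohc) _.
  apply: subset_leq_card; apply/subsetP=> _ /imsetP[a _ ->].
  by rewrite unary_comp; apply/imset_f/imset_f.
(* Extended by the identity, [h] becomes a permutation of [D]; its inverse is a power, so on [img c]
   it is given by an operation of the clone. *)
pose g a := if a \in img c then unary h a else a.
have gI : injective g.
  move=> a b; rewrite /g; case: ifP => aU; case: ifP => bU //; first exact: hI.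
    by move=> eab; rewrite -eab hU in bU.
  by move=> eab; rewrite eab hU in aU.
pose N := #[perm gI]%g.
have iterN a : iter N g a = a.
  by rewrite -[RHS](perm1 a) -(expg_order (perm gI)) permX; apply: eq_iter => b; rewrite permE.
have [w Ow wE] : exists2 w : operation D 1, O w & forall a, a \in img c -> unary w a = iter N.-1 g a.
  elim: N.-1 => [|j [w Ow wE]]; first by exists idop => [|a _]; [exact/holdsP | rewrite /unary !ffunE].
  exists (composition h (fun _ : 'I_1 => w)); first exact: O_unary_comp.
  move=> a aU; rewrite unary_comp wE //=; have : iter j g a \in img c.
    by elim: (j) => //= j' IH; rewrite /g IH hU.
  by move=> iU; rewrite [in RHS]/g iU.
have iterU j a : a \in img c -> iter j g a \in img c.
  by move=> aU; elim: j => //= j IH; rewrite /g IH hU.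
exists (composition w (fun _ : 'I_1 => composition c (fun _ : 'I_1 => p))); split.
- by apply: (clone_composition O_clone) => // _; apply: (clone_composition O_clone).
- move=> x s; rewrite !ffunE; congr (w _); apply/ffunP=> i; rewrite !ffunE.
  by congr (c _); apply/ffunP=> j; rewrite !ffunE; apply: symp.
- move=> x; rewrite ffunE unary_eta !ffunE unary_eta wE; last exact: imset_f.
  by apply/iterU/imset_f.
move=> a aU; rewrite ffunE unary_eta !ffunE unary_eta !ffunE wE; last exact: imset_f.
have -> : unary c (p [ffun=> a]) = g a by rewrite /g aU unary_comp unary_diagonal.
by rewrite -iterSr prednK ?order_gt0 ?iterN.
Qed.

Lemma perm_eq_ffun (T : Type) n (i0 : 'I_n) (from : 'I_n -> T) (l l' : seq 'I_n) : perm_eq l l' ->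
  exists s : 'S_(size l), [ffun i : 'I_(size l) => from (nth i0 l i)] =
    [ffun i => [ffun i : 'I_(size l) => from (nth i0 l' i)] (s i)].
Proof.
move=> pll'; have szl' : size l' == size l by rewrite (perm_size pll').
have /tuple_permP[s ls] : perm_eq l (Tuple szl') by [].
exists s; apply/ffunP=> i; rewrite !ffunE; congr from; rewrite {1}ls.
by rewrite (nth_map i) ?size_enum_ord // nth_ord_enum (tnth_nth i0).
Qed.

Definition permute k (x : {ffun 'I_k -> D}) (s : 'S_k) : {ffun 'I_k -> D} := [ffun i => x (s i)].

Lemma permuteM k (x : {ffun 'I_k -> D}) s t : permute (permute x s) t = permute x (t * s).
Proof. by apply/ffunP=> i; rewrite !ffunE permM. Qed.

Hypothesis O_sym : forall k, 0 < k <= #|D| -> exists f : operation D k, O f /\ symmetric_op f.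
Hypotheses (D_gt0 : 0 < #|D|) (D_le4 : #|D| <= 4).

(** * Symmetry at one tuple *)

Section LocalToGlobal.

Variables (k : nat) (Q : operation D k -> Prop) (x : {ffun 'I_k -> D}).
Hypothesis Q_neq0 : exists f, Q f.
Hypothesis Q_comp : forall m (p : operation D m) (F : 'I_m -> operation D k),
  O p -> (forall i, Q (F i)) -> Q (composition p F).
Hypothesis Q_perm : forall (f : operation D k) (s : 'S_k), Q f ->
  exists2 f', Q f' & forall y, f' y = f (permute y s).

(** The functions [s |-> f (permute x s)] with [f] in [Q] and values in [U], relabeled by ['I_m],
    form the translation-closed set [R]; a constant in [R] is an [f] symmetric at [x]. *)
Lemma constant_on_orbit : exists2 f, Q f & forall s, f x = f (permute x s).
Proof.
have [U [c [Oc cU core]]] := idempotent_core.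
have /card_gt0P[d0 _] := D_gt0; have d0U := cU d0.
set m := #|U|; pose from (i : 'I_m) : D := enum_val i.
pose to (d : D) : 'I_m := enum_rank_in d0U d.
have fromto d : d \in U -> from (to d) = d by apply: enum_rankK_in.
have tofrom i : to (from i) = i by apply: enum_valK_in.
have fromU i : from i \in U by apply: enum_valP.
have i0 : 'I_m := to (unary c d0).
(* Outside the range of arities an arbitrary operation makes the choice total. *)
have opP r : exists p : operation D r, 0 < r <= m ->
    [/\ O p, symmetric_op p, forall y, p y \in U & forall a, a \in U -> p [ffun=> a] = a].
  have [rm|] := boolP (0 < r <= m); last by exists [ffun=> d0].
  have [|f [Of symf]] := O_sym (k := r).
    by case/andP: rm => -> /leq_trans-> //; apply: max_card.
  by have [p pP] := core r f Of symf; exists p.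
pose op r : operation D r := sval (constructive_indefinite_description _ (opP r)).
have opE r : 0 < r <= m ->
    [/\ O (op r), symmetric_op (op r), forall y, op r y \in U
      & forall a, a \in U -> op r [ffun=> a] = a].
  exact: (svalP (constructive_indefinite_description _ (opP r))).
pose F r (l : seq 'I_m) := to (op r [ffun i : 'I_r => from (nth i0 l i)]).
pose sy l := F (size l) l.
have sySym : symmetric_family sy.
  split=> [r a|l l']; rewrite card_ord => rm; have [_ symp pU pid] := opE _ rm.
    rewrite /sy size_nseq /F -[RHS]tofrom -[in RHS](pid _ (fromU a)); congr (to (op r _)).
    by apply/ffunP=> i; rewrite !ffunE nth_nseq ltn_ord.
  move=> pll'; rewrite /sy -(perm_size pll') /F; have [s ->] := perm_eq_ffun i0 from pll'.
  by rewrite -symp.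
pose good f (v : {ffun 'S_k -> 'I_m}) := Q f /\ forall s, f (permute x s) = from (v s).
pose R := [set v | holds (exists f, good f v)].
have shR : shift_closed R.
  move=> v g; rewrite !inE => /holdsP[f [Qf fv]]; apply/holdsP.
  have [f' Qf' f'E] := Q_perm g Qf; exists f'; split=> // s.
  by rewrite f'E permuteM fv ffunE.
have R0 : R != set0.
  have [f Qf] := Q_neq0; apply/set0Pn; exists [ffun s => to (unary c (f (permute x s)))].
  rewrite inE; apply/holdsP; exists (composition c (fun _ : 'I_1 => f)); split.
    exact: Q_comp.
  by move=> s; rewrite !ffunE unary_eta ffunE fromto.
have stR r : 0 < r <= m -> closed_op r sy R.
  move=> rm us sz usR; have [Op symp pU pid] := opE _ rm.
  have usP (i : 'I_r) : exists f, good f (nth [ffun=> i0] us i).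
    by apply/holdsP; have := usR (nth [ffun=> i0] us i); rewrite inE; apply; rewrite mem_nth ?sz.
  pose G i := sval (constructive_indefinite_description _ (usP i)).
  have GP i : good (G i) (nth [ffun=> i0] us i).
    exact: (svalP (constructive_indefinite_description _ (usP i))).
  rewrite inE; apply/holdsP; exists (composition (op r) G); split.
    by apply: Q_comp => // i; case: (GP i).
  move=> s; rewrite !ffunE /sy size_map sz /F fromto //; congr (op r _).
  apply/ffunP=> i; rewrite !ffunE; have [_ ->] := GP i; congr from.
  by rewrite (nth_map [ffun=> i0]) ?sz.
have m_le4 : m <= 4 by apply: leq_trans D_le4; apply: max_card.
have [v] := constants_of_classified classified_le4 m_le4 sySym shR R0 stR.
rewrite inE => /holdsP[f [Qf fv]] cst; exists f => // s; rewrite fv (cst s 1%g) -fv.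
by congr (f _); apply/ffunP=> i; rewrite ffunE perm1.
Qed.

End LocalToGlobal.

(** Symmetry at the tuples already treated survives composing with a clone operation from outside
    and permuting the variables, so these operations form an admissible [Q]. *)
Lemma symmetric_on (k : nat) (X : seq {ffun 'I_k -> D}) : 0 < k ->
  exists2 f : operation D k, O f & forall x, x \in X -> forall s, f x = f (permute x s).
Proof.
move=> k_gt0; elim: X => [|x X [f0 Of0 f0X]].
  by exists (projection D (Ordinal k_gt0)) => //; apply: (clone_projection O_clone).
pose Q (f : operation D k) := O f /\ forall y, y \in X -> forall s, f y = f (permute y s).
have [|m p F Op QF|f s [Of fX]|f [Of fX] fx] := @constant_on_orbit k Q x.
- by exists f0.
- split=> [|y yX s].
    apply: (clone_composition O_clone) => // i; by case: (QF i).
  rewrite !ffunE; congr (p _); apply/ffunP=> i; rewrite !ffunE.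
  by have [_ /(_ y yX s)] := QF i.
- pose f' := composition f (fun i => projection D (s i)).
  have f'E y : f' y = f (permute y s).
    by rewrite ffunE; congr (f _); apply/ffunP=> i; rewrite !ffunE.
  exists f' => //; split.
    by apply: (clone_composition O_clone) => // i; apply: (clone_projection O_clone).
  by move=> y yX t; rewrite !f'E permuteM -!fX.
by exists f => // y; rewrite inE => /predU1P[-> //|/fX].
Qed.

End Clone.

Theorem theorem2 (D : finType) (O : forall k : nat, operation D k -> Prop)
    (D_nonempty : 0 < #|D|) (D_le4 : #|D| <= 4) (O_clone : clone O)
    (O_sym : forall k : nat, 0 < k <= #|D| ->
       exists f : operation D k, O k f /\ symmetric_op f) :
  forall k : nat, 0 < k -> exists f : operation D k, O k f /\ symmetric_op f.
Proof.
move=> k k_gt0.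
have [f Of fsym] := symmetric_on O_clone O_sym D_nonempty D_le4 (enum {ffun 'I_k -> D}) k_gt0.
by exists f; split=> // x s; apply: fsym; rewrite mem_enum.
Qed.
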